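(* Let $a<b$ and let $g\in\mathrm{BV}_{\mathrm{reg}}((a,b))$ be a function with the property that there exist $\alpha,c>0$ and $0<\delta<b-a$ such that $g(x)-g^+(a)\ge c(x-a)^\alpha$ for all $x\in(a,a+\delta]$. Assume that there exist $C,\eta>0$ such that $E(\delta,H)\ge CH^\eta$ for every $H\in[0,\bar H]$, where $\bar H=\operatorname{ess\,sup}_{(a,a+\delta]}g-g^+(a)$. Let $p\in[1,\infty]$, $\lambda>0$ and $\gamma>0$. If $$\gamma>\eta\left(1+\frac1{p\alpha}\right)^{-1}=\frac{p\alpha\eta}{p\alpha+1},$$ then $g$ is not a minimizer over $\mathrm{BV}((a,b))$ of the functional $$F(u)=\mathrm{TV}_{\phi,\theta}(u)+\lambda\|u-g\|_p^\gamma .$$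
   Context: Throughout, $\phi,\theta:[0,\infty)\to[0,\infty)$ are non-decreasing, $\phi$ is convex, $\theta$ is concave, $\phi(0)=\theta(0)=0$ and $\lim_{t\to\infty}\phi(t)/t=\lim_{t\to0^+}\theta(t)/t=1$. For a function $u$ of bounded variation on an open interval $I$, with derivative decomposed as $Du=u'\mathcal{L}^1+D^cu+D^ju$ (absolutely continuous, Cantor and jump parts), jump set $J_u$ and jumps $[u](x)=u^+(x)-u^-(x)$, the nonlinear total variation is $$\mathrm{TV}_{\phi,\theta}(u;I)=\int_I\phi(|u'(x)|)\,dx+|D^cu|(I)+\sum_{x\in J_u}\theta(|[u](x)|),$$ and $\mathrm{TV}_{\phi,\theta}(u)=\mathrm{TV}_{\phi,\theta}(u;(a,b))$. $u^\pm$ denote right/left limits (of a good representative). $\mathrm{BV}_{\mathrm{reg}}((a,b))$ is the set of functions $u:(a,b)\to\mathbb{R}$ of finite pointwise total variation such that $u(x)$ lies between $u^-(x)$ and $u^+(x)$ (inclusive) for every $x\in(a,b)$. For $L>0$, $H\ge0$, $$E(L,H)=\inf\{\mathrm{TV}_{\phi,\theta}(u;(0,L)) : u\in\mathrm{BV}((0,L)),\ u^+(0)=0,\ u^-(L)=H\}.$$ $\|\cdot\|_p$ is the $L^p$ norm on $(a,b)$. For $p=\infty$ the threshold $p\alpha\eta/(p\alpha+1)$ is interpreted as its limit $\eta$. *)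

(* Defs.v *)
From HB Require Import structures.
From mathcomp Require Import all_boot all_order all_algebra.
From mathcomp Require Import all_classical all_reals all_analysis.
From mathcomp Require Import ess_sup_inf.

Set Implicit Arguments.
Unset Strict Implicit.
Unset Printing Implicit Defensive.

Import Order.TTheory GRing.Theory Num.Theory.
Import numFieldNormedType.Exports.

Local Open Scope classical_set_scope.
Local Open Scope ring_scope.

(* Functions on an interval are represented by total functions on R; every
   notion below only depends on their values on the interval. Intervals are
   bounded, and finite signed measures on ]a, b[ are represented by charges on
   R of which only the values on measurable subsets of ]a, b[ are used. *)

Section signed_measures.
Context d (T : measurableType d) (R : realType).
Implicit Types nu : {charge set T -> \bar R}.
Local Open Scope ereal_scope.

Definition hahnP_set nu : set T := sval (cid (Hahn_decomposition nu)).

Definition hahnN_set nu : set T := sval (cid (svalP (cid (Hahn_decomposition nu)))).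

Definition hahnPN nu : hahn_decomposition nu (hahnP_set nu) (hahnN_set nu) :=
  svalP (cid (svalP (cid (Hahn_decomposition nu)))).

Definition variation_measure nu : set T -> \bar R := charge_variation (hahnPN nu).

Definition charge_integral nu (D : set T) (f : T -> \bar R) : \bar R :=
  \int[jordan_pos (hahnPN nu)]_(x in D) f x
  - \int[jordan_neg (hahnPN nu)]_(x in D) f x.

End signed_measures.

Section bounded_variation.
Context {R : realType}.
Implicit Types (a b x y : R) (u v f phi theta : R -> R).

Local Notation leb := (@lebesgue_measure R).
Local Notation charge_R := (charge (measurableTypeR R) R).

Definition test_function a b phi : Prop :=
  [/\ forall x, derivable phi x 1,
      continuous (derive1 phi) &
      exists c d, [/\ a < c, d < b & forall x, x \notin `[c, d] -> phi x = 0]].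

Definition weak_derivative a b u (Du : charge_R) : Prop :=
  forall phi, test_function a b phi ->
    (\int[leb]_(x in `]a, b[) (u x * derive1 phi x)%:E =
     - charge_integral Du `]a, b[ (EFin \o phi))%E.

Definition BV a b u : Prop :=
  leb.-integrable `]a, b[ (EFin \o u) /\ exists Du, weak_derivative a b u Du.

Definition pointwise_variation a b u : \bar R :=
  ereal_sup [set z | exists x y, [/\ a < x, x <= y, y < b & z = total_variation x y u]].

Definition good_representative a b u v : Prop :=
  (pointwise_variation a b v < +oo)%E /\
  {ae leb, forall x, x \in `]a, b[ -> u x = v x}.

(* Two good representatives have the same one-sided limits, so [xget] selects
   from a set with at most one element. *)
Definition rtrace a b u x : R :=
  xget 0 [set l | exists v, good_representative a b u v /\ v y @[y --> x^'+] --> l].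

Definition ltrace a b u x : R :=
  xget 0 [set l | exists v, good_representative a b u v /\ v y @[y --> x^'-] --> l].

Definition jump a b u x : R := rtrace a b u x - ltrace a b u x.

Definition jump_set a b u : set R := [set x | (x \in `]a, b[) /\ jump a b u x != 0].

(* Du = f L^1 + Dc + Dj on ]a, b[, where Dc is singular and has no atoms, and
   Dj is the sum over x in J_u of [u](x) times the Dirac mass at x (J_u is
   countable). *)
Definition bv_decomposition a b u f (Dc Dj : charge_R) : Prop :=
  [/\ exists2 Du : charge_R, weak_derivative a b u Du &
        forall A, measurable A -> A `<=` `]a, b[ ->
          Du A = (\int[leb]_(x in A) (f x)%:E + Dc A + Dj A)%E,
      leb.-integrable `]a, b[ (EFin \o f),
      (exists N, [/\ measurable N, leb N = 0%E &
         forall A, measurable A -> A `<=` `]a, b[ -> A `&` N = set0 -> Dc A = 0%E])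
      /\ (forall x, x \in `]a, b[ -> Dc [set x] = 0%E) &
      (forall A, measurable A -> A `<=` `]a, b[ -> A `&` jump_set a b u = set0 ->
         Dj A = 0%E)
      /\ (forall x, jump_set a b u x -> Dj [set x] = (jump a b u x)%:E)].

(* For u in BV the decomposition exists and is unique (u' up to a null set,
   Dc and Dj on subsets of ]a, b[), so the infimum is over a singleton. *)
Definition TV phi theta a b u : \bar R :=
  ereal_inf [set z | exists f Dc Dj, bv_decomposition a b u f Dc Dj /\
    z = (\int[leb]_(x in `]a, b[) (phi `|f x|)%:E
         + variation_measure Dc `]a, b[
         + \esum_(x in jump_set a b u) (theta `|jump a b u x|)%:E)%E].

Definition BVreg a b u : Prop :=
  (pointwise_variation a b u < +oo)%E /\
  forall x, x \in `]a, b[ ->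
    Num.min (ltrace a b u x) (rtrace a b u x) <= u x
      <= Num.max (ltrace a b u x) (rtrace a b u x).

Definition jump_energy phi theta (L H : R) : \bar R :=
  ereal_inf [set TV phi theta 0 L u | u in
    [set u | [/\ BV 0 L u, rtrace 0 L u 0 = 0 & ltrace 0 L u L = H]]].

Definition Lp_norm a b (p : \bar R) u : \bar R :=
  'N[leb]_p [EFin \o (u \_ `]a, b[)]%E.

Definition fidelity_functional phi theta a b (g : R -> R) (p : \bar R)
    (lambda gamma : R) u : \bar R :=
  (TV phi theta a b u + lambda%:E * Lp_norm a b p (u \- g)%R `^ gamma)%E.

Definition is_minimizer (S : set (R -> R)) (F : (R -> R) -> \bar R) u : Prop :=
  S u /\ forall v, S v -> (F u <= F v)%E.

Definition ess_sup_on a b u : \bar R :=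
  ess_sup (mrestr leb (@measurable_itv R `]a, b])) (EFin \o u).

Definition admissible_densities phi theta : Prop :=
  [/\ [/\ forall t, 0 <= t -> 0 <= phi t, phi 0 = 0,
         {in `[0, +oo[ &, {homo phi : s t / s <= t}},
         convex_function (`[0, +oo[%classic : set R) phi &
         phi t / t @[t --> +oo] --> (1 : R)] &
      [/\ forall t, 0 <= t -> 0 <= theta t, theta 0 = 0,
         {in `[0, +oo[ &, {homo theta : s t / s <= t}},
         convex_function (`[0, +oo[%classic : set R) (\- theta) &
         theta t / t @[t --> 0^'+] --> (1 : R)]].

(* p alpha eta / (p alpha + 1), read as its limit eta for p = +oo. *)
Definition threshold (p : \bar R) (alpha eta : R) : R :=
  if p is r%:E then r * alpha * eta / (r * alpha + 1) else eta.

End bounded_variation.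

(* Main.v *)
(** Let [S] be the supremum of [g] over a small interval [(a, r)] and
    [s = S - g^+(a) > 0].  Since [g] has bounded variation and takes values between
    its one-sided limits, [S] is a one-sided limit of [g] at some point [x] of
    [(a, r]], and the growth condition gives [x - a <= (s / c)^(1/alpha)].  Let [u]
    be [S] before [x] and [g] after, and let [v] be [g] before [x] and [S] after.
    The restriction of [Dg] to a right interval starting at [x], closed or open
    according to which one-sided limit equals [S], is [Du], and its restriction to
    the complement is [Dv]; no jump is split, so [TV u + TV v <= TV g].  By
    translation [TV v] on [(a, a + delta)] is at least [E(delta, s) >= C s^eta],
    whereas the fidelity term of [u] is of order [s^(gamma (1 + 1/(p alpha)))], which
    is smaller when [s] is small.  That [Du] is a restriction of [Dg] follows by
    testing the weak derivative of [g] with products of a test function and C^1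
    cutoffs converging to the indicator function of [(x, +oo)]. *)

(* The cut is made at a one-sided limit because of [theta]. Cutting at a value strictly between the
   limits of a jump would divide that jump in two, and a concave [theta] with [theta 0 = 0]
   satisfies [theta s + theta t >= theta (s + t)] for nonnegative s, t, so the energy could grow. At
   a one-sided limit the whole atom of Dg at x goes to one side, and the sum over jumps splits like
   a measure.

   Derivatives and their decompositions are existential, and [TV] is an infimum over decompositions,
   equal to +oo when there is none. No general existence theorem is proved: each comparison carries
   an arbitrary decomposition of one function over to another. A first decomposition of Dg comes
   from minimality, since comparison with the zero function makes [TV] finite at g. Finiteness also
   permits the cancellation of TV u in C s^eta + TV u <= TV g <= TV u + lambda D s^kappa, where
   kappa = gamma (1 + 1/(p alpha)) and D depends only on c and the exponents. The hypothesis on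
   gamma amounts to eta < kappa, so this chain fails for small s. *)
Require Import Defs.
From HB Require Import structures.
From mathcomp Require Import all_boot all_order all_algebra.
From mathcomp Require Import all_classical all_reals all_analysis.
From mathcomp Require Import ess_sup_inf measurable_realfun ring lra.

Set Implicit Arguments.
Unset Strict Implicit.
Unset Printing Implicit Defensive.

Import Order.TTheory GRing.Theory Num.Theory.
Import numFieldNormedType.Exports.

Local Open Scope classical_set_scope.
Local Open Scope ring_scope.

(** * Bounded variation and one-sided limits *)

Section variation_dominated.
Context {R : realType}.
Implicit Types (a b c x y M : R) (u v P : R -> R).

(** A bounded majorant P in place of the total variation: it is real valued, P and P - u are both
    nondecreasing, and reflection, translation and gluing of u act directly on P. *)
Definition variation_dominated a b u P M : Prop :=
  (forall s, a < s -> s < b -> `|P s| <= M) /\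
  (forall s t, a < s -> s <= t -> t < b -> `|u t - u s| <= P t - P s).

Lemma variation_dominated_pointwise a b u P M :
  variation_dominated a b u P M -> (pointwise_variation a b u < +oo)%E.
Proof.
(* With u = (P + u) - P, a difference of nondecreasing functions, the variation on [x, y] is at most
   2 (P y - P x) + (u y - u x) <= 3 (P y - P x) <= 6 M. *)
move=> [bP dP]; apply: (@le_lt_trans _ _ (6 * M)%:E); last exact: ltry.
apply: ge_ereal_sup => _ [x [y [ax xy yb ->]]].
have -> : u = (P \+ u) \+ (\- P) by apply/funext => z /=; lra.
have inxy z : z \in `[x, y] -> a < z < b.
  by rewrite in_itv/= => /andP[xz zy]; rewrite (lt_le_trans ax xz) (le_lt_trans zy yb).
apply: (le_trans (total_variation_le _ _ xy)).
rewrite total_variationN !nondecreasing_total_variation//; first last.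
- move=> s t /inxy /andP[as_ sb] /inxy /andP[at_ tb] st /=.
  have := dP _ _ as_ st tb; rewrite ler_norml => /andP[]; lra.
- move=> s t /inxy /andP[as_ sb] /inxy /andP[at_ tb] st /=.
  have := dP _ _ as_ st tb; rewrite ler_norml => /andP[]; lra.
have ay := lt_le_trans ax xy; have xb := le_lt_trans xy yb.
have := bP _ ax xb; have := bP _ ay yb; have := dP _ _ ax xy yb.
rewrite -EFinD lee_fin !ler_norml /= => /andP[? ?] /andP[? ?] /andP[? ?]; lra.
Qed.

Lemma pointwise_variation_dominated a b u : a < b ->
  (pointwise_variation a b u < +oo)%E -> exists P M, variation_dominated a b u P M.
Proof.
move=> ab fu.
pose c := (a + b) / 2.
have ac : a < c by rewrite /c; lra.
have cb : c < b by rewrite /c; lra.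
have le_pv x y : a < x -> x <= y -> y < b ->
    (total_variation x y u <= pointwise_variation a b u)%E.
  by move=> *; apply: ereal_sup_ubound; exists x, y.
have pvfin : pointwise_variation a b u \is a fin_num.
  rewrite ge0_fin_numE//; apply: le_trans (le_pv c c ac (lexx c) cb).
  exact: total_variation_ge0.
have tvfin x y : a < x -> x <= y -> y < b -> total_variation x y u \is a fin_num.
  move=> ax xy yb; rewrite ge0_fin_numE ?total_variation_ge0//.
  exact: le_lt_trans (le_pv _ _ ax xy yb) fu.
pose T x y := fine (total_variation x y u).
have T0 x y : a < x -> x <= y -> y < b -> 0 <= T x y.
  by move=> ax xy yb; rewrite fine_ge0// total_variation_ge0.
have TM x y : a < x -> x <= y -> y < b -> T x y <= fine (pointwise_variation a b u).
  by move=> ax xy yb; rewrite fine_le ?tvfin ?le_pv.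
have Tge x y : a < x -> x <= y -> y < b -> `|u y - u x| <= T x y.
  move=> ax xy yb; rewrite -lee_fin fineK ?tvfin//; exact: total_variation_ge.
have TD x y z : a < x -> x <= y -> y <= z -> z < b -> T x z = T x y + T y z.
  move=> ax xy yz zb; rewrite /T (total_variationD _ xy yz) fineD// tvfin//.
    exact: le_lt_trans yz zb.
  exact: lt_le_trans ax xy.
(* Signed variation measured from the midpoint [c], since the endpoints do not belong to the
   interval. *)
exists (fun y => if c <= y then T c y else - T y c), (fine (pointwise_variation a b u)).
split=> [s as_ sb|s t as_ st tb].
  have [cs|/ltW sc] := leP c s; rewrite ?normrN ger0_norm ?T0 ?TM//.
have at_ := lt_le_trans as_ st; have sb := le_lt_trans st tb.
have := Tge _ _ as_ st tb.
have [ct|/[dup] tc /ltW tc'] := leP c t; have [cs|/[dup] sc /ltW sc'] := leP c s.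
- by rewrite (TD _ _ _ ac cs st tb); lra.
- by rewrite (TD _ _ _ as_ sc' ct tb); lra.
- by have := le_trans cs st; rewrite leNgt tc.
- by rewrite (TD _ _ _ as_ st tc' cb); lra.
Qed.

Lemma variation_dominated_nondecreasing a b u P M s t :
  variation_dominated a b u P M ->
  a < s -> s <= t -> t < b -> P s <= P t /\ P s - u s <= P t - u t.
Proof.
move=> [_ dP] as_ st tb; have := dP _ _ as_ st tb.
rewrite ler_norml => /andP[? ?]; split; lra.
Qed.

Lemma variation_dominated_bounded a b u P M : a < b ->
  variation_dominated a b u P M ->
  exists K, forall x, a < x -> x < b -> `|u x| <= K.
Proof.
move=> ab [bP dP]; pose c := (a + b) / 2.
have ac : a < c by rewrite /c; lra.
have cb : c < b by rewrite /c; lra.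
exists (`|u c| + 2 * M) => x ax xb.
have := bP _ ax xb; have := bP _ ac cb.
rewrite !ler_norml => /andP[? ?] /andP[? ?].
have := ler_norm (u c); have := ler_norm (- u c); rewrite normrN.
have [xc|/ltW cx] := leP x c.
  have := dP _ _ ax xc cb; rewrite ler_norml => /andP[? ?] ? ?; apply/andP; split; lra.
have := dP _ _ ac cx xb; rewrite ler_norml => /andP[? ?] ? ?; apply/andP; split; lra.
Qed.

(** P and P - u are monotone and bounded, hence have right limits; u is their difference. Left
    limits follow by reflection. *)
Lemma variation_dominated_right_cvg a b u P M x : a <= x -> x < b ->
  variation_dominated a b u P M -> cvg (u y @[y --> x^'+]).
Proof.
move=> ax xb dom; have ab := le_lt_trans ax xb.
have [K bu] := variation_dominated_bounded ab dom.
have inxb z : z \in `]x, b[ -> a < z /\ z < b.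
  by rewrite in_itv/= => /andP[xz zb]; split=> //; exact: le_lt_trans ax xz.
have [bP _] := dom.
have cP : cvg (P y @[y --> x^'+]).
  apply/cvg_ex; eexists.
  apply: (@nondecreasing_at_right_cvgr _ _ _ (BLeft b)); first by rewrite bnd_simp.
    move=> s t /inxb[? ?] /inxb[? ?] st.
    by have [] := variation_dominated_nondecreasing dom _ st _.
  exists (- M) => _ [y /inxb[ay yb] <-].
  by have := bP _ ay yb; rewrite ler_norml => /andP[].
have cPu : cvg ((P \- u) y @[y --> x^'+]).
  apply/cvg_ex; eexists.
  apply: (@nondecreasing_at_right_cvgr _ _ _ (BLeft b)); first by rewrite bnd_simp.
    move=> s t /inxb[? ?] /inxb[? ?] st.
    by have [] := variation_dominated_nondecreasing dom _ st _.
  exists (- M - K) => _ [y /inxb[ay yb] <-].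
  have := bP _ ay yb; have := bu _ ay yb.
  by rewrite !ler_norml /= => /andP[? ?] /andP[? ?]; lra.
have -> : u = P \- (P \- u) by apply/funext => z /=; lra.
exact: is_cvgB.
Qed.

Lemma variation_dominated_reflect a b u P M :
  variation_dominated a b u P M ->
  variation_dominated (- b) (- a) (u \o -%R) (\- (P \o -%R)) M.
Proof.
move=> [bP dP]; split=> [s bs sa|s t bs st ta] /=.
  by rewrite normrN bP//; lra.
by rewrite distrC (le_trans (dP _ _ _ _ _))//; lra.
Qed.

Lemma variation_dominated_left_cvg a b u P M x : a < x -> x <= b ->
  variation_dominated a b u P M -> cvg (u y @[y --> x^'-]).
Proof.
move=> ax xb /variation_dominated_reflect dom.
have /cvg_ex[/= l] : cvg ((u \o -%R) y @[y --> (- x)^'+]).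
  by apply: variation_dominated_right_cvg dom; lra.
by move=> ul; apply/cvg_ex; exists l; exact/cvg_at_leftNP.
Qed.

End variation_dominated.

(** * Traces as one-sided limits of good representatives *)

Section traces.
Context {R : realType}.
Implicit Types (a b c x y M : R) (u v : R -> R).

Lemma lebesgue_aeS2 (P Q S : R -> Prop) : (forall x, P x -> Q x -> S x) ->
  {ae @lebesgue_measure R, forall x, P x} ->
  {ae @lebesgue_measure R, forall x, Q x} ->
  {ae @lebesgue_measure R, forall x, S x}.
Proof.
move=> PQS; apply: filterS2; [exact: (ae_filter_ringOfSetsType lebesgue_measure)|].
exact: PQS.
Qed.

Lemma good_representative_refl a b u :
  (pointwise_variation a b u < +oo)%E -> good_representative a b u u.
Proof. by move=> uoo; split=> //; exact: aeW. Qed.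

Lemma ae_eq_frequently x y (Q : R -> Prop) : x < y ->
  {ae @lebesgue_measure R, forall z, Q z} -> exists z, [/\ x < z, z < y & Q z].
Proof.
move=> xy [N [mN N0 subN]]; apply: contrapT => nQ.
have : (lebesgue_measure `]x, y[%classic <= lebesgue_measure N)%E.
  apply: le_measure; rewrite ?inE//= => z /=; rewrite in_itv/= => /andP[xz zy].
  by apply: subN => /= Qz; apply: nQ; exists z.
rewrite N0 lebesgue_measure_itv/= lte_fin xy -EFinB lee_fin; lra.
Qed.

Lemma right_limit_ae_unique x b u v (l m : R) : x < b ->
  {ae @lebesgue_measure R, forall y, y \in `]x, b[ -> u y = v y} ->
  u y @[y --> x^'+] --> l -> v y @[y --> x^'+] --> m -> l = m.
Proof.
move=> xb uv ul vm; apply/eqP; rewrite -subr_eq0 -normr_le0 leNgt; apply/negP => lm0.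
have e0 : 0 < `|l - m| / 4 by lra.
move/cvgrPdist_lt/(_ _ e0): ul => ul'; move/cvgrPdist_lt/(_ _ e0): vm => vm'.
have [e /= e_gt0 He] := filterI ul' vm'.
have xe : x < Num.min b (x + e) by rewrite lt_min xb ltrDl.
have [z [xz zb uvz]] := ae_eq_frequently xe uv.
move: zb; rewrite lt_min => /andP[zb ze].
have [] := He z _ xz; first by rewrite /ball/= distrC gtr0_norm; lra.
rewrite uvz ?in_itv/= ?xz// => lt1 lt2.
by have := ler_distD (v z) l m; rewrite (distrC (v z)); lra.
Qed.

Lemma left_limit_ae_unique a x u v (l m : R) : a < x ->
  {ae @lebesgue_measure R, forall y, y \in `]a, x[ -> u y = v y} ->
  u y @[y --> x^'-] --> l -> v y @[y --> x^'-] --> m -> l = m.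
Proof.
move=> ax uv ul vm; apply/eqP; rewrite -subr_eq0 -normr_le0 leNgt; apply/negP => lm0.
have e0 : 0 < `|l - m| / 4 by lra.
move/cvgrPdist_lt/(_ _ e0): ul => ul'; move/cvgrPdist_lt/(_ _ e0): vm => vm'.
have [e /= e_gt0 He] := filterI ul' vm'.
have xe : Num.max a (x - e) < x by rewrite gt_max ax gtrBl.
have [z [az zx uvz]] := ae_eq_frequently xe uv.
move: az; rewrite gt_max => /andP[az ze].
have [] := He z _ zx; first by rewrite /ball/= gtr0_norm; lra.
rewrite uvz ?in_itv/= ?az// => lt1 lt2.
by have := ler_distD (v z) l m; rewrite (distrC (v z)); lra.
Qed.

Lemma good_representative_ae_eq a b u v w :
  good_representative a b u v -> good_representative a b u w ->
  {ae @lebesgue_measure R, forall y, y \in `]a, b[ -> v y = w y}.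
Proof.
move=> [_ uv] [_ uw]; apply: lebesgue_aeS2 uv uw => y uv uw yab.
by rewrite -uv// uw.
Qed.

(** The choice made by [xget] is harmless: two good representatives agree almost everywhere, and
    every interval to the right of x has positive measure, so their right limits coincide. *)
Lemma rtraceE a b u v x (l : R) : a <= x -> x < b ->
  good_representative a b u v -> v y @[y --> x^'+] --> l -> rtrace a b u x = l.
Proof.
move=> ax xb uv vl; rewrite /rtrace; case: xgetP => [m _ [w [uw wm]]|/(_ l)[]].
  apply: right_limit_ae_unique wm vl; first exact: xb.
  have wv := good_representative_ae_eq uw uv.
  apply: (lebesgue_aeS2 _ wv wv) => y + _ yxb; apply.
  move: yxb; rewrite !in_itv/= => /andP[xy ->]; rewrite andbT; exact: le_lt_trans xy.
by exists v.
Qed.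

Lemma ltraceE a b u v x (l : R) : a < x -> x <= b ->
  good_representative a b u v -> v y @[y --> x^'-] --> l -> ltrace a b u x = l.
Proof.
move=> ax xb uv vl; rewrite /ltrace; case: xgetP => [m _ [w [uw wm]]|/(_ l)[]].
  apply: left_limit_ae_unique wm vl; first exact: ax.
  have wv := good_representative_ae_eq uw uv.
  apply: (lebesgue_aeS2 _ wv wv) => y + _ yxb; apply.
  move: yxb; rewrite !in_itv/= => /andP[-> yx]; exact: lt_le_trans xb.
by exists v.
Qed.

Lemma rtrace_cvg a b u x : a <= x -> x < b ->
  (pointwise_variation a b u < +oo)%E -> u y @[y --> x^'+] --> rtrace a b u x.
Proof.
move=> ax xb uoo; have ab := le_lt_trans ax xb.
have [P [M dom]] := pointwise_variation_dominated ab uoo.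
have /cvg_ex[/= l ul] := variation_dominated_right_cvg ax xb dom.
by rewrite (rtraceE ax xb (good_representative_refl uoo) ul).
Qed.

Lemma ltrace_cvg a b u x : a < x -> x <= b ->
  (pointwise_variation a b u < +oo)%E -> u y @[y --> x^'-] --> ltrace a b u x.
Proof.
move=> ax xb uoo; have ab := lt_le_trans ax xb.
have [P [M dom]] := pointwise_variation_dominated ab uoo.
have /cvg_ex[/= l ul] := variation_dominated_left_cvg ax xb dom.
by rewrite (ltraceE ax xb (good_representative_refl uoo) ul).
Qed.

End traces.

(** * Integrals with respect to charges *)

Section bounded_on.
Context {T : Type} {R : realType}.
Implicit Types (A B : set T) (f : T -> R).

Lemma bounded_subset A B f : [bounded f x | x in A] -> B `<=` A ->
  [bounded f x | x in B].
Proof. by move=> [M [Mr AM]] BA; exists M; split=> // m /AM Am x /BA /Am. Qed.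

Lemma bounded_by A f (M : R) : (forall x, A x -> `|f x| <= M) ->
  [bounded f x | x in A].
Proof.
move=> AM; exists M; split; first exact: num_real.
by move=> m Mm x /AM fM; exact: le_trans fM (ltW Mm).
Qed.

End bounded_on.

Section charge_variation_integral.
Context d (T : measurableType d) (R : realType).
Implicit Types (nu : {charge set T -> \bar R}) (A B D : set T) (f : T -> R).
Local Open Scope ereal_scope.

Lemma abse_le_variation_measure nu A : measurable A ->
  `|nu A| <= variation_measure nu A.
Proof. exact: abse_charge_variation. Qed.

Lemma variation_measure_ge0 nu A : 0 <= variation_measure nu A.
Proof. by rewrite /variation_measure /charge_variation adde_ge0. Qed.

(** Makes the variation accessible without handling Hahn decompositions again: the bound is applied
    to the positive and the negative part of D, whose masses under m add up to m D. *)
Lemma variation_measure_le nu (m : {measure set T -> \bar R}) D : measurable D ->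
  (forall E, measurable E -> E `<=` D -> `|nu E| <= m E) ->
  variation_measure nu D <= m D.
Proof.
move=> mD num; rewrite /variation_measure /charge_variation/=.
have [[mP posP] [mN negN] PNT PN0] := hahnPN nu.
rewrite jordan_posE jordan_negE cjordan_posE cjordan_negE /crestr0 mem_set//.
rewrite /crestr.
have DE : D = (D `&` hahnP_set nu) `|` (D `&` hahnN_set nu).
  by rewrite -setIUr PNT setIT.
rewrite [X in _ <= m X]DE measureU; last 3 first.
- exact: measurableI.
- exact: measurableI.
- by rewrite setIACA PN0 setI0.
apply: leeD.
  apply: le_trans (num _ _ (@subIsetl _ _ _)); last exact: measurableI.
  exact: lee_abs.
apply: le_trans (num _ _ (@subIsetl _ _ _)); last exact: measurableI.
by rewrite -abseN; exact: lee_abs.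
Qed.

Lemma fin_num_eq_subC (p q r s : \bar R) : p \is a fin_num -> q \is a fin_num ->
  r \is a fin_num -> s \is a fin_num -> p - q = r - s <-> p + s = r + q.
Proof.
move: p q r s => [p| |] [q| |] [r| |] [s| |] // _ _ _ _.
by rewrite -!EFinN -!EFinD; split=> -[?]; congr _%:E; lra.
Qed.

Lemma jordan_decompB nu A : measurable A ->
  nu A = jordan_pos (hahnPN nu) A - jordan_neg (hahnPN nu) A.
Proof. by move=> mA; rewrite (jordan_decomp (hahnPN nu) mA) /cadd/= cscaleN1. Qed.

(** Frees the integral from the chosen Jordan decomposition. On subsets of D the measures [jp + m2]
    and [m1 + jn] coincide; integrating f against both and subtracting finite terms gives the
    formula. *)
Lemma charge_integralE nu (m1 m2 : {measure set T -> \bar R}) D f :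
  measurable D -> measurable_fun D f -> [bounded f x | x in D] ->
  m1 D < +oo -> m2 D < +oo ->
  (forall A, measurable A -> A `<=` D -> nu A = m1 A - m2 A) ->
  charge_integral nu D (EFin \o f) =
  \int[m1]_(x in D) (f x)%:E - \int[m2]_(x in D) (f x)%:E.
Proof.
move=> mD mf bf m1D m2D num.
have fint (m : {measure set T -> \bar R}) : m D < +oo -> m.-integrable D (EFin \o f).
  by move=> mDoo; exact: measurable_bounded_integrable.
have mfin (m : {measure set T -> \bar R}) A : m D < +oo -> measurable A ->
    A `<=` D -> m A \is a fin_num.
  move=> mDoo mA AD; rewrite ge0_fin_numE//; apply: le_lt_trans mDoo.
  by apply: le_measure; rewrite ?inE.
pose jp : {finite_measure set T -> \bar R} := jordan_pos (hahnPN nu).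
pose jn : {finite_measure set T -> \bar R} := jordan_neg (hahnPN nu).
have jpD : jp D < +oo by rewrite ltey_eq fin_num_measure.
have jnD : jn D < +oo by rewrite ltey_eq fin_num_measure.
have E : \int[measure_add jp m2]_(x in D) (f x)%:E =
    \int[measure_add m1 jn]_(x in D) (f x)%:E.
  apply: eq_measure_integral => A mA AD.
  rewrite -[LHS]/(measure_add jp m2 A) -[RHS]/(measure_add m1 jn A) !measure_addE.
  apply/fin_num_eq_subC; rewrite ?mfin//.
  by rewrite -num// (jordan_decompB nu mA).
rewrite (integral_measure_add mD (fint _ jpD) (fint _ m2D)) in E.
rewrite (integral_measure_add mD (fint _ m1D) (fint _ jnD)) in E.
by apply/fin_num_eq_subC => //; apply: integrable_fin_num => //; exact: fint.
Qed.

Lemma eq_charge_integral nu1 nu2 D f :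
  measurable D -> measurable_fun D f -> [bounded f x | x in D] ->
  (forall A, measurable A -> A `<=` D -> nu1 A = nu2 A) ->
  charge_integral nu1 D (EFin \o f) = charge_integral nu2 D (EFin \o f).
Proof.
move=> mD mf bf nu12; rewrite [RHS]/charge_integral; apply: charge_integralE => //.
- by rewrite ltey_eq fin_num_measure.
- by rewrite ltey_eq fin_num_measure.
by move=> A mA AD; rewrite nu12// (jordan_decompB nu2 mA).
Qed.

Lemma charge_integral_eq0 nu D f :
  measurable D -> measurable_fun D f -> [bounded f x | x in D] ->
  (forall A, measurable A -> A `<=` D -> nu A = 0) ->
  charge_integral nu D (EFin \o f) = 0.
Proof.
move=> mD mf bf nu0.
rewrite (@charge_integralE nu mzero mzero D f mD mf bf (ltry 0) (ltry 0)).
  by rewrite !integral_measure_zero sube0.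
by move=> A mA AD; rewrite /= /mzero sube0 nu0.
Qed.

Lemma charge_integral_fin_num nu D f :
  measurable D -> measurable_fun D f -> [bounded f x | x in D] ->
  charge_integral nu D (EFin \o f) \is a fin_num.
Proof.
move=> mD mf bf; rewrite /charge_integral.
by rewrite fin_numB !integrable_fin_num//;
  apply: measurable_bounded_integrable => //; rewrite ltey_eq fin_num_measure.
Qed.

Lemma charge_integralU nu A B f : measurable A -> measurable B ->
  [disjoint A & B] ->
  measurable_fun (A `|` B) f -> [bounded f x | x in A `|` B] ->
  charge_integral nu (A `|` B) (EFin \o f) =
  charge_integral nu A (EFin \o f) + charge_integral nu B (EFin \o f).
Proof.
move=> mA mB AB mf bf; have mAB : measurable (A `|` B) by exact: measurableU.
have fint (m : {finite_measure set T -> \bar R}) : m.-integrable (A `|` B) (EFin \o f).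
  by apply: measurable_bounded_integrable => //; rewrite ltey_eq fin_num_measure.
have fintA m := integrableS mAB mA (@subsetUl _ A B) (fint m).
have fintB m := integrableS mAB mB (@subsetUr _ A B) (fint m).
rewrite /charge_integral; pose jp := jordan_pos (hahnPN nu).
pose jn := jordan_neg (hahnPN nu); rewrite -/jp -/jn.
rewrite !integral_setU_EFin//; [|exact/(measurable_int jp)..].
have := integrable_fin_num mA (fintA jp); have := integrable_fin_num mA (fintA jn).
have := integrable_fin_num mB (fintB jp); have := integrable_fin_num mB (fintB jn).
move=> /=.
case: (integral jp A _) => [p| |]//; case: (integral jn A _) => [q| |]//.
case: (integral jp B _) => [r| |]//; case: (integral jn B _) => [s| |]//.
by move=> _ _ _ _; rewrite -!EFinD; congr _%:E; lra.
Qed.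

(** The Hahn decomposition chosen for the restricted charge is unrelated to that of [nu], so D is
    split instead: the charges agree on subsets of D in A, and the restriction vanishes on the
    rest. *)
Lemma charge_integral_crestr nu A (mA : measurable A) D f :
  measurable D -> measurable_fun D f -> [bounded f x | x in D] ->
  charge_integral (crestr nu mA) D (EFin \o f) =
  charge_integral nu (D `&` A) (EFin \o f).
Proof.
move=> mD mf bf; have DE : D = (D `&` A) `|` (D `\` A) by rewrite setUIDK.
have bfS B : B `<=` D -> [bounded f x | x in B].
  exact: bounded_subset bf.
have mDA : measurable (D `&` A) by exact: measurableI.
have mDB : measurable (D `\` A) by exact: measurableD.
rewrite [in LHS]DE charge_integralU -?DE//; last first.
  by rewrite disj_set2E; apply/eqP; rewrite setDE setIACA setICr setI0.
rewrite [X in _ + X]charge_integral_eq0//; last 3 first.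
- by apply: measurable_funS mf => //; exact: subDsetl.
- by apply: bfS; exact: subDsetl.
- move=> B mB BD; rewrite /= /crestr (_ : B `&` A = set0) ?charge0//.
  by apply/seteqP; split => // x [/BD[]].
rewrite adde0; apply: eq_charge_integral => //.
- by apply: measurable_funS mf => //; exact: subIsetl.
- by apply: bfS; exact: subIsetl.
- by move=> B mB BD; rewrite /= /crestr (_ : B `&` A = B)//; apply/setIidPl => x /BD[].
Qed.

Lemma charge_integral_set1 nu x f : measurable [set x] ->
  charge_integral nu [set x] (EFin \o f) = (f x)%:E * nu [set x].
Proof.
move=> mx; rewrite /charge_integral (jordan_decompB nu mx).
have E (m : {measure set T -> \bar R}) :
    \int[m]_(y in [set x]) (f y)%:E = (f x)%:E * m [set x].
  rewrite -(@integral_cst _ _ _ m _ mx (f x)%:E).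
  by apply: eq_integral => y; rewrite inE/= => ->.
by rewrite !E muleBr// fin_num_adde_defr// fin_num_measure.
Qed.

Lemma charge_integral_dominated_cvg nu D (f_ : nat -> T -> R) f (M : R) :
  measurable D -> (forall n, measurable_fun D (f_ n)) -> measurable_fun D f ->
  (forall n x, D x -> (`|f_ n x| <= M)%R) ->
  (forall x, D x -> f_ ^~ x @ \oo --> f x) ->
  charge_integral nu D (EFin \o f_ n) @[n --> \oo] --> charge_integral nu D (EFin \o f).
Proof.
move=> mD mf_ mf bf f_f.
have cv (m : {finite_measure set T -> \bar R}) :
    \int[m]_(x in D) (f_ n x)%:E @[n --> \oo] --> \int[m]_(x in D) (f x)%:E
    /\ \int[m]_(x in D) (f x)%:E \is a fin_num.
  have [|||||fi _ c] := @dominated_convergence _ _ _ m D mD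
    (fun n => EFin \o f_ n) (EFin \o f) (cst M%:E).
  - by move=> n; exact/measurable_EFinP.
  - exact/measurable_EFinP.
  - by apply: aeW => x Dx; apply: cvg_EFin; [exact: nearW|exact: f_f].
  - by apply: finite_measure_integrable_cst.
  - by apply: aeW => x n Dx /=; rewrite lee_fin bf.
  - by split=> //; exact: integrable_fin_num.
rewrite /charge_integral; have [c1 f1] := cv (jordan_pos (hahnPN nu)).
have [c2 f2] := cv (jordan_neg (hahnPN nu)).
by apply: cvgeB => //; rewrite fin_num_adde_defr.
Qed.

End charge_variation_integral.

(** * Images of charges under measurable maps *)

Section charge_pushforward.
Context d (T : measurableType d) (R : realType).
Implicit Types (nu : {charge set T -> \bar R}).
Local Open Scope ereal_scope.

Lemma integral_pushforward_on d' (U : measurableType d') (h : T -> U)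
    (mh : measurable_fun setT h) (m : {measure set T -> \bar R}) (D : set U)
    (f : U -> \bar R) : measurable D -> measurable_fun D f ->
  \int[pushforward m h]_(y in D) f y = \int[m]_(x in h @^-1` D) f (h x).
Proof.
move=> mD mf; rewrite [LHS]integralE [RHS]integralE.
rewrite (ge0_integral_pushforward mh m mD (measurable_funepos mf) (fun _ _ => funepos_ge0 _ _)).
rewrite (ge0_integral_pushforward mh m mD (measurable_funeneg mf) (fun _ _ => funeneg_ge0 _ _)).
by congr (_ - _); apply: eq_integral => x _ /=; rewrite ?funeposE ?funenegE.
Qed.

Lemma charge_pushforward_exists d' (U : measurableType d') (h : T -> U)
    (mh : measurable_fun setT h) nu :
  exists nu' : {charge set U -> \bar R}, forall A : set U, nu' A = nu (h @^-1` A).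
Proof. by unshelve eexists (pushforward nu h : {charge set U -> \bar R}). Qed.

Lemma charge_integral_pushforward d' (U : measurableType d') (h : T -> U)
    (mh : measurable_fun setT h) nu (nu' : {charge set U -> \bar R}) (D : set U)
    (f : U -> R) : measurable D -> measurable_fun D f -> [bounded f x | x in D] ->
  (forall A : set U, measurable A -> nu' A = nu (h @^-1` A)) ->
  charge_integral nu' D (EFin \o f) = charge_integral nu (h @^-1` D) (EFin \o (f \o h)).
Proof.
move=> mD mf bf nu'E; rewrite [RHS]/charge_integral.
have mhA (A : set U) : measurable A -> measurable (h @^-1` A).
  by move=> mA; rewrite -[X in measurable X]setTI; exact: mh.
have mfE : measurable_fun D (EFin \o f) by exact/measurable_EFinP.
pose jp : {finite_measure set T -> \bar R} := jordan_pos (hahnPN nu).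
pose jn : {finite_measure set T -> \bar R} := jordan_neg (hahnPN nu).
rewrite -(integral_pushforward_on mh jp mD mfE) -(integral_pushforward_on mh jn mD mfE).
apply: charge_integralE => //.
- by rewrite ltey_eq /= /pushforward fin_num_measure//; exact: mhA.
- by rewrite ltey_eq /= /pushforward fin_num_measure//; exact: mhA.
- by move=> A mA _; rewrite nu'E//= /pushforward (jordan_decompB nu (mhA _ mA)).
Qed.

End charge_pushforward.

(** * Weak derivatives on half intervals *)

Section cutoff.
Context {R : realType}.
Implicit Types (x y t h k : R) (f F : R -> R).

(** Serves piecewise quadratic functions: one global inequality replaces a discussion of the
    derivative at each knot. *)
Lemma is_derive1_quadratic_remainder f x l K :
  (forall h, `|f (x + h) - f x - l * h| <= K * h ^+ 2) -> is_derive x 1 f l.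
Proof.
move=> fK; have K0 : 0 <= K.
  by have := le_trans (normr_ge0 _) (fK 1); rewrite expr1n mulr1.
apply/is_derive1_caratheodory.
exists (fun z => if z == x then l else (f z - f x) / (z - x)); split.
- move=> z; case: eqVneq => [->|zx]; first by rewrite !subrr mulr0.
  by rewrite divfK// subr_eq0.
- apply/cvgrPdist_le => e e0; rewrite eqxx.
  have e1 : 0 < e / (K + 1) by rewrite divr_gt0// ltr_wpDl.
  near=> z; case: eqVneq => [_|zx]; first by rewrite subrr normr0 ltW.
  have zx0 : z - x != 0 by rewrite subr_eq0.
  rewrite -(@ler_pM2r _ `|z - x|) ?normr_gt0// -normrM mulrBl divfK// distrC.
  apply: (le_trans (y := K * (z - x) ^+ 2)).
    by have := fK (z - x); rewrite addrCA subrr addr0.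
  rewrite -real_normK ?num_real// expr2 mulrA ler_wpM2r//.
  have : `|z - x| <= e / (K + 1).
    by rewrite distrC; near: z; exact: cvgr_dist_le.
  rewrite ler_pdivlMr ?ltr_wpDl//; apply: le_trans.
  by rewrite mulrC ler_wpM2l// lerDl.
- by rewrite eqxx.
Unshelve. all: by end_near. Qed.

(* The quadratic spline: a C^1 step from 0 to 1 on [0, 1]. *)
Definition smooth_step t : R :=
  2 * Num.max 0 t ^+ 2 - 4 * Num.max 0 (t - 2^-1) ^+ 2 + 2 * Num.max 0 (t - 1) ^+ 2.

(** The hat function on [0, 1] with peak 2 at 1/2, of unit mass. *)
Definition smooth_step' t : R :=
  4 * Num.max 0 t - 8 * Num.max 0 (t - 2^-1) + 4 * Num.max 0 (t - 1).

Lemma smooth_step_le0 t : t <= 0 -> smooth_step t = 0 /\ smooth_step' t = 0.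
Proof.
move=> t0; rewrite /smooth_step /smooth_step'.
by rewrite !max_l//; [split; ring|lra..].
Qed.

Lemma smooth_step_ge1 t : 1 <= t -> smooth_step t = 1 /\ smooth_step' t = 0.
Proof.
move=> t1; rewrite /smooth_step /smooth_step'.
by rewrite !max_r; [split; field|lra..].
Qed.

Lemma smooth_step_bounds t :
  0 <= smooth_step t <= 1 /\ 0 <= smooth_step' t <= 2.
Proof.
have [t0|t0] := leP t 0; first by have [-> ->] := smooth_step_le0 t0; split; lra.
have [t1|t1] := leP 1 t; first by have [-> ->] := smooth_step_ge1 t1; split; lra.
rewrite /smooth_step /smooth_step' (max_r (ltW t0)) (@max_l _ _ 0 (t - 1)); last lra.
have [t2|t2] := leP (t - 2^-1) 0; first by split; apply/andP; split; nra.
by split; apply/andP; split; nra.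
Qed.

Lemma square_max0_remainder t h :
  `|Num.max 0 (t + h) ^+ 2 - Num.max 0 t ^+ 2 - 2 * Num.max 0 t * h| <= h ^+ 2.
Proof.
rewrite ler_norml; have [t0|t0] := leP t 0; have [th0|th0] := leP (t + h) 0.
all: by apply/andP; split; nra.
Qed.

(** Each truncated square has remainder at most h^2, and 8 = 2 + 4 + 2 is the sum of the absolute
    values of their coefficients. *)
Lemma smooth_step_remainder t h :
  `|smooth_step (t + h) - smooth_step t - smooth_step' t * h| <= 8 * h ^+ 2.
Proof.
have := square_max0_remainder t h; have := square_max0_remainder (t - 2^-1) h.
have := square_max0_remainder (t - 1) h.
rewrite /smooth_step /smooth_step' (addrAC t h) (addrAC t h (- 1)) !ler_norml.
by move=> /andP[? ?] /andP[? ?] /andP[? ?]; apply/andP; split; nra.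
Qed.

Lemma continuous_smooth_step' : continuous smooth_step'.
Proof.
have cmax (y : R) : continuous (fun t : R => Num.max 0 (t - y)).
  move=> t; apply: (@continuous_max _ _ (fun=> 0) (fun t : R => t - y)).
    exact: cvg_cst.
  by apply: cvgB; [exact: cvg_id|exact: cvg_cst].
have -> : smooth_step' = (fun t => 4 * Num.max 0 (t - 0) -
    8 * Num.max 0 (t - 2^-1) + 4 * Num.max 0 (t - 1)).
  by apply/funext => t; rewrite subr0.
move=> t; apply: cvgD; first apply: cvgB.
- by apply: cvgM; [exact: cvg_cst|exact: cmax].
- by apply: cvgM; [exact: cvg_cst|exact: cmax].
- by apply: cvgM; [exact: cvg_cst|exact: cmax].
Qed.

(** The ramp lies in [x, x + 1/k], entirely to the right of x. The limit for large k therefore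
    vanishes at x itself, so an atom of Du at x is left out, and the derivative of the ramp sees
    only the right limit of u. *)
Definition cutoff x k y : R := smooth_step (k * (y - x)).

Definition cutoff' x k y : R := k * smooth_step' (k * (y - x)).

Lemma is_derive_cutoff x k y : is_derive y 1 (cutoff x k) (cutoff' x k y).
Proof.
apply: (@is_derive1_quadratic_remainder _ _ _ (8 * k ^+ 2)) => h.
have := smooth_step_remainder (k * (y - x)) (k * h).
rewrite /cutoff /cutoff' -mulrDr exprMn (mulrA 8).
have -> : smooth_step' (k * (y - x)) * (k * h) = k * smooth_step' (k * (y - x)) * h.
  by rewrite mulrCA mulrA.
by rewrite (addrAC y).
Qed.

Lemma continuous_cutoff' x k : continuous (cutoff' x k).
Proof.
move=> y; apply: cvgM; first exact: cvg_cst.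
apply: (@continuous_comp _ _ _ (fun y => k * (y - x)) smooth_step').
  apply: cvgM; first exact: cvg_cst.
  by apply: cvgB; [exact: cvg_id|exact: cvg_cst].
exact: continuous_smooth_step'.
Qed.

Lemma cutoff_left x k y : 0 < k -> y <= x -> cutoff x k y = 0 /\ cutoff' x k y = 0.
Proof.
move=> k0 yx; rewrite /cutoff /cutoff'.
have [|-> ->] := @smooth_step_le0 (k * (y - x)); last by rewrite mulr0.
by rewrite pmulr_rle0// subr_le0.
Qed.

Lemma cutoff_right x k y : 0 < k -> x + k^-1 <= y ->
  cutoff x k y = 1 /\ cutoff' x k y = 0.
Proof.
move=> k0 yx; rewrite /cutoff /cutoff'.
have [|-> ->] := @smooth_step_ge1 (k * (y - x)); last by rewrite mulr0.
by rewrite mulrC -ler_pdivrMr// mul1r lerBrDl.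
Qed.

Lemma cutoff_bounds x k y : 0 < k ->
  0 <= cutoff x k y <= 1 /\ 0 <= cutoff' x k y <= 2 * k.
Proof.
move=> k0; rewrite /cutoff /cutoff'.
have [-> /andP[? ?]] := smooth_step_bounds (k * (y - x)); split=> //.
by apply/andP; split; nra.
Qed.

Lemma near_natSinv_le x y : x < y -> \forall n \near \oo, x + n.+1%:R^-1 <= y.
Proof.
rewrite -subr_gt0 => xy; have := near_infty_natSinv_lt (PosNum xy).
by apply: filterS => n /= /ltW; rewrite lerBrDl.
Qed.

Lemma cutoff_cvg x y : cutoff x n.+1%:R y @[n --> \oo] --> (if x < y then 1 else 0 : R).
Proof.
case: ifPn => [xy|]; last first.
  rewrite -leNgt => yx; apply: cvg_near_cst; apply: nearW => n.
  by have [->] := @cutoff_left x n.+1%:R y (ltr0Sn _ _) yx.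
apply: cvg_near_cst; apply: filterS (near_natSinv_le xy) => n xny.
by have [->] := @cutoff_right x n.+1%:R y (ltr0Sn _ _) xny.
Qed.

End cutoff.

Section fundamental_theorem.
Context {R : realType}.
Implicit Types (F : R -> R) (s t : R).
Local Notation leb := (@lebesgue_measure R).

Lemma derivable_continuous F : (forall x, derivable F x 1) -> continuous F.
Proof. by move=> dF x; apply/differentiable_continuous/derivable1_diffP. Qed.

Lemma continuous_bounded_segment F s t : continuous F ->
  exists M : R, forall x, s <= x <= t -> `|F x| <= M.
Proof.
move=> cF; have : compact (F @` `[s, t]).
  by apply: continuous_compact (@segment_compact _ _ _); exact: continuous_subspaceT.
move=> /compact_bounded[M [Mr MF]]; exists (`|M| + 1) => x sxt.
by apply: (MF (`|M| + 1)); [rewrite (le_lt_trans (ler_norm M))// ltrDl|exists x].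
Qed.

Lemma is_derive_integral F (dF : R -> R) s t : s <= t ->
  (forall x : R, is_derive x 1 F (dF x)) -> continuous dF ->
  (\int[leb]_(x in `]s, t[) (dF x)%:E = (F t - F s)%:E)%E.
Proof.
rewrite le_eqVlt => /predU1P[->|st] DF cF.
  by rewrite set_itv_ge ?bnd_simp -?leNgt// integral_set0 subrr.
have dF1 x : derivable F x 1 by exact: (@ex_derive _ _ _ _ _ _ _ (DF x)).
have cF0 := derivable_continuous dF1.
have mF : measurable_fun `]s, t[ (EFin \o dF).
  by apply/measurable_EFinP; apply: measurable_funTS; exact: continuous_measurable_fun.
have <- := integral_itv_bndoo true false mF.
have cFst : {within `[s, t], continuous dF} by exact: continuous_subspaceT.
have dFst : derivable_oo_LRcontinuous F s t.
  split=> [x _||]; first exact: dF1.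
    by apply: cvg_at_right_filter; exact: cF0.
  by apply: cvg_at_left_filter; exact: cF0.
apply: (continuous_FTC2 st cFst dFst) => x _.
by rewrite derive1E; exact: (@derive_val _ _ _ _ _ _ _ (DF x)).
Qed.

End fundamental_theorem.

(** * Integration by parts on a right half interval *)

Section weak_derivative_pieces.
Context {R : realType}.
Implicit Types (a b x y k l L : R) (u phi w : R -> R).
Local Notation mR := (measurableTypeR R).
Local Notation leb := (@lebesgue_measure R).
Local Notation charge_R := (charge (measurableTypeR R) R).

Lemma continuous_mul u w : continuous u -> continuous w ->
  continuous (fun y => u y * w y).
Proof. by move=> cu cw y; apply: cvgM; [exact: cu|exact: cw]. Qed.

Lemma continuous_add u w : continuous u -> continuous w ->
  continuous (fun y => u y + w y).
Proof. by move=> cu cw y; apply: cvgD; [exact: cu|exact: cw]. Qed.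

Lemma derivable_cutoff x k y : derivable (cutoff x k) y 1.
Proof. exact: (@ex_derive _ _ _ _ _ _ _ (is_derive_cutoff x k y)). Qed.

Lemma cutoff'_integral a b x k : 0 < k -> a <= x -> x + k^-1 <= b ->
  (\int[leb]_(y in `]a, b[) (cutoff' x k y)%:E = 1)%E.
Proof.
move=> k0 ax xb; have ab : a <= b by rewrite (le_trans ax)// (le_trans _ xb)// lerDl invr_ge0 ltW.
rewrite (is_derive_integral ab (is_derive_cutoff x k) (@continuous_cutoff' _ x k)).
by have [-> _] := cutoff_left k0 ax; have [-> _] := cutoff_right k0 xb; rewrite subr0.
Qed.

(** Lets [derive1 phi] be replaced by a variable, known only to be continuous and to be the
    derivative. *)
Lemma test_function_derivative a b phi : test_function a b phi ->
  exists dphi : R -> R, [/\ derive1 phi = dphi,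
    forall y : R, is_derive y 1 phi (dphi y) & continuous dphi].
Proof.
move=> [dphi cphi' _]; exists (derive1 phi); split=> //.
by move=> y; rewrite derive1E; exact: derivableP.
Qed.

Lemma is_derive_test_function a b phi (dphi : R -> R) :
  (forall y : R, is_derive y 1 phi (dphi y)) -> continuous dphi ->
  (exists c d, [/\ a < c, d < b & forall x, x \notin `[c, d] -> phi x = 0]) ->
  test_function a b phi /\ derive1 phi = dphi.
Proof.
move=> Dphi cdphi phi0; have E : derive1 phi = dphi.
  by apply/funext => y; rewrite derive1E; exact: (@derive_val _ _ _ _ _ _ _ (Dphi y)).
split=> //; split; [|by rewrite E|exact: phi0].
by move=> y; exact: (@ex_derive _ _ _ _ _ _ _ (Dphi y)).
Qed.

Lemma is_derive_mul_cutoff phi l x k y : is_derive y 1 phi l ->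
  is_derive y 1 (fun z => phi z * cutoff x k z)
    (l * cutoff x k y + phi y * cutoff' x k y).
Proof.
move=> Dphi; have := is_deriveM Dphi (is_derive_cutoff x k y).
by rewrite /GRing.scale/= addrC (mulrC (cutoff _ _ _)).
Qed.

Lemma test_function_cutoff a b phi (dphi : R -> R) x k : test_function a b phi ->
  (forall y : R, is_derive y 1 phi (dphi y)) -> continuous dphi ->
  test_function a b (fun y => phi y * cutoff x k y) /\
  derive1 (fun y => phi y * cutoff x k y) =
    (fun y => dphi y * cutoff x k y + phi y * cutoff' x k y).
Proof.
move=> [phi1 _ [c [d [ac db phi0]]]] Dphi cdphi.
have ck := derivable_continuous (@derivable_cutoff x k).
have cphi := derivable_continuous phi1.
apply: is_derive_test_function.
- by move=> y; apply: is_derive_mul_cutoff.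
- apply: continuous_add; first exact: continuous_mul.
  by apply: continuous_mul => //; exact: continuous_cutoff'.
- by exists c, d; split=> // y /phi0 ->; rewrite mul0r.
Qed.

Lemma continuous_measurable_on (D : set mR) w : measurable D -> continuous w ->
  measurable_fun D (w : mR -> R).
Proof. by move=> mD cw; apply: measurable_funTS; exact: continuous_measurable_fun. Qed.

Lemma continuous_bounded_on a b w : continuous w -> [bounded w y | y in `]a, b[].
Proof.
move=> cw; have [M wM] := continuous_bounded_segment a b cw.
by apply: (@bounded_by _ _ _ _ M) => y /=; rewrite in_itv/= => /andP[/ltW ay /ltW yb];
  apply: wM; rewrite ay yb.
Qed.

Lemma integrable_mul_continuous a b u w :
  leb.-integrable `]a, b[ (EFin \o u) -> continuous w ->
  leb.-integrable `]a, b[ (EFin \o (fun y => u y * w y)).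
Proof.
move=> iu cw.
have mI : measurable (`]a, b[%classic : set mR) by exact: measurable_itv.
exact: (integrableMl mI iu (continuous_measurable_on mI cw) (continuous_bounded_on a b cw)).
Qed.

Lemma integrable_cst_itv a b (r : R) : leb.-integrable `]a, b[ (EFin \o cst r).
Proof.
apply: measurable_bounded_integrable => //.
  by rewrite /= lebesgue_measure_itv/=; case: ifP; rewrite ?ltry// -EFinB ltry.
by apply: (@bounded_by _ _ _ _ `|r|).
Qed.

Lemma integrable_continuous a b w : continuous w ->
  leb.-integrable `]a, b[ (EFin \o w).
Proof.
move=> cw; have := integrable_mul_continuous (integrable_cst_itv a b 1) cw.
by under [EFin \o _]eq_fun do rewrite /= mul1r.
Qed.

(** The kernels are nonnegative, have unit mass and live on ]x, x + 1/(n+1)[, where w is close to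
    its right limit. *)
Lemma cutoff'_concentration a b x w L : a <= x -> x < b ->
  leb.-integrable `]a, b[ (EFin \o w) -> w y @[y --> x^'+] --> L ->
  (\int[leb]_(y in `]a, b[) (w y * cutoff' x n.+1%:R y)%:E @[n --> \oo] --> L%:E)%E.
Proof.
move=> ax xb iw wL.
have iwk n := integrable_mul_continuous iw (@continuous_cutoff' _ x n.+1%:R).
have ik n := integrable_continuous a b (@continuous_cutoff' _ x n.+1%:R).
apply/fine_cvgP; split; first by apply: nearW => n; exact: (integrable_fin_num _ (iwk n)).
apply/cvgrPdist_le => e e0.
move/cvgrPdist_le/(_ _ e0): wL => [d /= d0 wd].
have xd : x < Num.min b (x + d) by rewrite lt_min xb ltrDl d0.
apply: filterS (near_natSinv_le xd) => n; rewrite le_min => /andP[xnb xnd].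
have k1 := cutoff'_integral (ltr0Sn _ n) ax xnb.
rewrite /= distrC.
(* Writing both L and e as multiples of the unit mass reduces the estimate to a pointwise comparison
   of integrands. *)
have -> : L = L * \int[leb]_(y in `]a, b[) cutoff' x n.+1%:R y.
  by rewrite /Rintegral k1 mulr1.
have -> : e = e * \int[leb]_(y in `]a, b[) cutoff' x n.+1%:R y.
  by rewrite /Rintegral k1 mulr1.
have mI : measurable (`]a, b[%classic : set mR) by exact: measurable_itv.
rewrite -!RintegralZl//.
have iZ (r : R) : leb.-integrable `]a, b[ (EFin \o (fun y => r * cutoff' x n.+1%:R y)).
  exact: (integrableZl _ r (ik n)).
rewrite -[X in X - _]/(\int[leb]_(y in `]a, b[) (w y * cutoff' x n.+1%:R y))%R.
rewrite -RintegralB; [|exact: mI|exact: iwk|exact: iZ].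
have iD : leb.-integrable `]a, b[
    (EFin \o (fun y => w y * cutoff' x n.+1%:R y - L * cutoff' x n.+1%:R y)).
  by have := integrableB mI (iwk n) (iZ L); apply: eq_integrable.
apply: (le_trans (le_normr_Rintegral mI iD)).
apply: le_Rintegral => //; first exact: (integrable_norm iD).
move=> y; rewrite /= in_itv/= => /andP[ay yb]; rewrite -mulrBl.
have [_ /andP[k0 _]] := @cutoff_bounds _ x n.+1%:R y (ltr0Sn _ _).
rewrite normrM (ger0_norm k0).
have [yx|xy] := leP y x.
  by have [_ ->] := @cutoff_left _ x n.+1%:R y (ltr0Sn _ _) yx; rewrite !mulr0.
have [xny|ynx] := leP (x + n.+1%:R^-1) y.
  by have [_ ->] := @cutoff_right _ x n.+1%:R y (ltr0Sn _ _) xny; rewrite !mulr0.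
apply: ler_wpM2r => //; rewrite distrC; apply: wd => //=.
rewrite /ball/= ltr_distlC; apply/andP; split; first by rewrite (lt_trans _ xy)// gtrBl.
exact: lt_le_trans xnd.
Qed.

(** Du is tested with phi times a cutoff. In the product rule, the term with the derivative of phi
    and the charge integral converge by dominated convergence to integrals over ]x, b[; the term
    with the derivative of the cutoff concentrates at x and leaves the boundary term l phi(x). *)
Lemma weak_derivative_right a b u (Du : charge_R) x l phi : a < x -> x < b ->
  leb.-integrable `]a, b[ (EFin \o u) -> weak_derivative a b u Du ->
  u y @[y --> x^'+] --> l -> test_function a b phi ->
  (\int[leb]_(y in `]x, b[) (u y * derive1 phi y)%:E =
   - (l * phi x)%:E - charge_integral Du `]x, b[ (EFin \o phi))%E.
Proof.
move=> ax xb iu wu ul tphi; have [dphi [-> Dphi cdphi]] := test_function_derivative tphi.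
have cphi : continuous phi by have [dphi1 _ _] := tphi; exact: derivable_continuous.
have mI : measurable (`]a, b[%classic : set mR) by exact: measurable_itv.
have mJ : measurable (`]x, b[%classic : set mR) by exact: measurable_itv.
pose k n := cutoff x n.+1%:R; pose k' n := cutoff' x n.+1%:R.
have ck n : continuous (k n) := derivable_continuous (@derivable_cutoff x n.+1%:R).
have ck' n : continuous (k' n) := @continuous_cutoff' _ x n.+1%:R.
have k01 n y : `|k n y| <= 1.
  have [/andP[k0 k1] _] := @cutoff_bounds _ x n.+1%:R y (ltr0Sn _ n).
  by rewrite ger0_norm.
pose J y : R := if x < y then 1 else 0.
have JE y : J y = \1_(`]x, +oo[) y.
  by rewrite /J indicE mem_setE in_itv/= andbT; case: (x < y).
have mJf : measurable_fun setT (J : mR -> R).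
  by rewrite (funext JE); apply: measurable_indic; exact: measurable_itv.
have kJ y : k n y @[n --> \oo] --> J y := @cutoff_cvg _ x y.
have IJ : (`]a, b[ `&` `]x, +oo[ = `]x, b[%classic :> set R)%classic.
  apply/seteqP; split => y /=; rewrite !in_itv/= andbT.
    by move=> [/andP[_ ->] ->].
  by move=> /andP[xy ->]; rewrite (lt_trans ax xy) xy.
have split n : (\int[leb]_(y in `]a, b[) (u y * (dphi y * k n y))%:E +
    \int[leb]_(y in `]a, b[) ((u y * phi y) * k' n y)%:E =
    - charge_integral Du `]a, b[ (EFin \o (fun y => phi y * k n y)%R))%E.
  have [tk dk] := @test_function_cutoff a b phi dphi x n.+1%:R tphi Dphi cdphi.
  rewrite -(wu _ tk) dk -integralD_EFin//.
  - by apply: eq_integral => y _ /=; rewrite -EFinD; congr _%:E; rewrite /k /k'; ring.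
  - exact: (integrable_mul_continuous iu (continuous_mul cdphi (ck n))).
  - exact: (integrable_mul_continuous (integrable_mul_continuous iu cphi) (ck' n)).
have iuphi' := integrable_mul_continuous iu cdphi.
have U : (\int[leb]_(y in `]a, b[) (u y * (dphi y * k n y))%:E @[n --> \oo] -->
    \int[leb]_(y in `]x, b[) (u y * dphi y)%:E)%E.
  have -> : (\int[leb]_(y in `]x, b[) (u y * dphi y)%:E =
    \int[leb]_(y in `]a, b[) (u y * (dphi y * J y))%:E)%E.
    rewrite -IJ integral_mkcondr; apply: eq_integral => y _ /=.
    rewrite patchE /J mem_setE in_itv/= andbT; case: ifP => _; rewrite ?mulr1//.
    by rewrite !mulr0.
  have [|||||_ _ UU] := @dominated_convergence _ _ _ leb `]a, b[ mI
    (fun n y => (u y * (dphi y * k n y))%:E)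
    (fun y => (u y * (dphi y * J y))%:E)
    (fun y => `|(u y * dphi y)%:E|%E).
  - move=> n; apply: measurable_int.
    exact: (integrable_mul_continuous iu (continuous_mul cdphi (ck n))).
  - apply/measurable_EFinP; apply: measurable_funM.
      by apply/measurable_EFinP; exact: (measurable_int leb iu).
    apply: measurable_funM; first exact: continuous_measurable_on.
    exact: measurable_funTS.
  - apply: aeW => y _; apply: cvg_EFin; first exact: nearW.
    by apply: cvgM; [exact: cvg_cst|apply: cvgM; [exact: cvg_cst|exact: kJ]].
  - exact: (integrable_abse iuphi').
  - apply: aeW => y n _ /=; rewrite lee_fin mulrA normrM ler_piMr//.
  - exact: UU.
have uphil : u y * phi y @[y --> x^'+] --> l * phi x.
  by apply: cvgM => //; apply: cvg_at_right_filter; exact: cphi.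
have V := cutoff'_concentration (ltW ax) xb (integrable_mul_continuous iu cphi) uphil.
have bphi := continuous_bounded_on a b cphi.
have [M phiM] := continuous_bounded_segment a b cphi.
have W : (charge_integral Du `]a, b[ (EFin \o (fun y => phi y * k n y)%R) @[n --> \oo] -->
    charge_integral Du `]x, b[ (EFin \o phi))%E.
  have bphiJ : [bounded phi y * J y | y in `]a, b[].
    apply: (@bounded_by _ _ _ _ M) => y /=; rewrite in_itv/= => /andP[/ltW ay /ltW yb].
    apply: le_trans (phiM y _); last by rewrite ay yb.
    by rewrite normrM ler_piMr// /J; case: ifP; rewrite ?normr1 ?normr0.
  have mphiJ : measurable_fun `]a, b[ (fun y : mR => phi y * J y).
    apply: measurable_funM; first exact: continuous_measurable_on.
    exact: measurable_funTS.
  have -> : charge_integral Du `]x, b[ (EFin \o phi) =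
      charge_integral Du `]a, b[ (EFin \o (fun y => phi y * J y)).
    rewrite /charge_integral -IJ !integral_mkcondr.
    congr (_ - _)%E; apply: eq_integral => y _ /=.
      rewrite patchE /J mem_setE in_itv/= andbT; case: ifP => _; rewrite ?mulr1//.
      by rewrite mulr0.
    rewrite patchE /J mem_setE in_itv/= andbT; case: ifP => _; rewrite ?mulr1//.
    by rewrite mulr0.
  apply: (@charge_integral_dominated_cvg _ _ _ Du _ (fun n y => phi y * k n y) _ M) => //.
  - by move=> n; exact: (continuous_measurable_on mI (continuous_mul cphi (ck n))).
  - move=> n y /=; rewrite in_itv/= => /andP[/ltW ay /ltW yb].
    apply: le_trans (phiM y _); last by rewrite ay yb.
    by rewrite normrM ler_piMr.
  - by move=> y _; apply: cvgM; [exact: cvg_cst|exact: kJ].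
have iuphi'J := integrableS mI mJ _ iuphi'.
have fU : (\int[leb]_(y in `]x, b[) (u y * dphi y)%:E)%E \is a fin_num.
  apply: integrable_fin_num => //; apply: iuphi'J => y /=; rewrite !in_itv/= => /andP[xy ->].
  by rewrite (lt_trans ax xy).
have fW : charge_integral Du `]x, b[ (EFin \o phi) \is a fin_num.
  apply: charge_integral_fin_num => //; first exact: continuous_measurable_on.
  exact: continuous_bounded_on.
have UV : (- charge_integral Du `]a, b[ (EFin \o (fun y => phi y * k n y)%R)
    @[n --> \oo] --> \int[leb]_(y in `]x, b[) (u y * dphi y)%:E + (l * phi x)%:E)%E.
  by under eq_fun do rewrite -split; apply: cvgeD => //; exact: fin_num_adde_defr.
have WN := cvgeN W.
have : (\int[leb]_(y in `]x, b[) (u y * dphi y)%:E + (l * phi x)%:E =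
    - charge_integral Du `]x, b[ (EFin \o phi))%E.
  by apply: cvg_unique UV (WN _); exact: ereal_hausdorff.
move: fU fW; case: (integral _ _ _) => [p| |]//; case: (charge_integral _ _ _) => [q| |]//.
by move=> _ _; rewrite -!EFinN -!EFinD => -[?]; congr _%:E; lra.
Qed.

End weak_derivative_pieces.

(** * Replacing a function by a constant to the left of a point *)

Section weak_derivative_gluing.
Context {R : realType}.
Implicit Types (a b x y k l : R) (u phi w : R -> R).
Local Notation mR := (measurableTypeR R).
Local Notation leb := (@lebesgue_measure R).
Local Notation charge_R := (charge (measurableTypeR R) R).

Lemma test_function_endpoint a b phi : test_function a b phi ->
  forall y, (y <= a) || (b <= y) -> phi y = 0.
Proof.
move=> [_ _ [c [d [ac db phi0]]]] y yab; apply: phi0.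
rewrite in_itv/= negb_and -!ltNge; case/orP: yab => yab.
  by rewrite (le_lt_trans yab ac).
by rewrite (lt_le_trans db yab) orbT.
Qed.

Lemma test_function_derivative_integral a b x phi : test_function a b phi ->
  a < x -> (\int[leb]_(y in `]a, x[) (derive1 phi y)%:E = (phi x)%:E)%E.
Proof.
move=> tphi ax; have [dphi [-> Dphi cdphi]] := test_function_derivative tphi.
rewrite (is_derive_integral (ltW ax) Dphi cdphi) (test_function_endpoint tphi (y := a)) ?lexx//.
by rewrite subr0.
Qed.

(** As a left bound, [BSide B x] includes x exactly when B is true. Isolating the part of D at x
    lets one argument treat the closed and the open interval. *)
Lemma itv_split (s x t : R) (B : bool) (D : set R) : s < x -> x < t ->
  D = [set` Interval (BSide B x) (BLeft t)] ->
  (`]s, t[%classic = `]s, x[ `|` (`[x, t[) /\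
  `]s, t[ `&` D = `]x, t[ `|` ([set x] `&` D))%classic.
Proof.
move=> sx xt ->; split; apply/seteqP; split => y /=; rewrite !in_itv/=.
- by move=> /andP[sy ->]; rewrite sy andbT; have [yx|xy] := ltP y x; [left|right].
- by move=> [/andP[-> yx]|/andP[xy ->]]; rewrite ?(lt_trans yx xt)// (lt_le_trans sx xy).
- move=> [/andP[sy yt]]; case: B => /= /andP[xy _]; last by left; rewrite xy.
  move: xy; rewrite le_eqVlt => /predU1P[<-|->]; last by left.
  by right; split=> //; rewrite eqxx xt.
- move=> [/andP[xy yt]|[-> xD]].
    by rewrite yt (lt_trans sx xy); case: B => /=; rewrite ?xy ?(ltW xy).
  by split=> //; rewrite sx xt.
Qed.

Lemma integrable_glue a b u x k : leb.-integrable `]a, b[ (EFin \o u) ->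
  leb.-integrable `]a, b[ (EFin \o (fun y => if y < x then k else u y)).
Proof.
move=> iu; have mI : measurable (`]a, b[%classic : set mR) by exact: measurable_itv.
have mu : measurable_fun `]a, b[ (u : mR -> R).
  by apply/measurable_EFinP; exact: (measurable_int leb iu).
have mw : measurable_fun `]a, b[ ((fun y => if y < x then k else u y) : mR -> R).
  apply: measurable_fun_if => //.
  - apply: measurable_funTS; apply: (@measurable_fun_ltr _ _ _ setT id (cst x)).
      exact: measurable_id.
    exact: measurable_cst.
  - apply: measurable_funS mu => //; exact: subIsetl.
have iuk := integrableD mI (integrable_abse iu) (integrable_cst_itv a b `|k|).
apply: le_integrable iuk => //; first exact/measurable_EFinP.
move=> y _ /=; rewrite lee_fin (ger0_norm (addr_ge0 _ _))//.
by case: ifP => _; rewrite ?lerDl ?lerDr.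
Qed.

(** The constant left of x contributes k phi(x), the right half contributes - l phi(x) and the
    integral over ]x, b[. The remaining (k - l) phi(x) is exactly what the atom of the restricted
    charge at x supplies, by the hypothesis on its mass. *)
Lemma weak_derivative_glue a b u (Du : charge_R) x l k (B : bool) (A : set mR)
    (mA : measurable A) :
  a < x -> x < b -> A = [set` Interval (BSide B x) (BLeft b)] ->
  leb.-integrable `]a, b[ (EFin \o u) -> weak_derivative a b u Du ->
  u y @[y --> x^'+] --> l -> Du ([set x] `&` A)%classic = (l - k)%:E ->
  weak_derivative a b (fun y => if y < x then k else u y) (crestr Du mA).
Proof.
move=> ax xb AE iu wu ul DuxA phi tphi.
have mI : measurable (`]a, b[%classic : set mR) by exact: measurable_itv.
have mIx : measurable (`]a, x[%classic : set mR) by exact: measurable_itv.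
have mJx : measurable (`[x, b[%classic : set mR) by exact: measurable_itv.
have mJ : measurable (`]x, b[%classic : set mR) by exact: measurable_itv.
have mx : measurable ([set x] : set mR) by rewrite -set_itv1; exact: measurable_itv.
have [IE IAE] := itv_split ax xb AE.
have right_piece := weak_derivative_right ax xb iu wu ul tphi.
have left_piece := test_function_derivative_integral tphi ax.
have cphi : continuous phi by have [dphi1 _ _] := tphi; exact: derivable_continuous.
move: right_piece left_piece.
have [dphi [-> Dphi cdphi]] := test_function_derivative tphi.
move=> right_piece left_piece.
set w := (fun y => if y < x then k else u y).
have iw := integrable_mul_continuous (integrable_glue x k iu) cdphi.
rewrite [in LHS]IE integral_setU//; last 2 first.
- by rewrite -IE; exact: (measurable_int leb iw).
- rewrite disj_set2E; apply/eqP/seteqP; split => // y [] /=; rewrite !in_itv/=.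
  by move=> /andP[_ yx] /andP[]; rewrite leNgt yx.
have -> : (\int[leb]_(y in `]a, x[) (w y * dphi y)%:E = (k * phi x)%:E)%E.
  rewrite EFinM -left_piece -integralZl//; last exact: integrable_continuous.
  apply: eq_integral => y; rewrite inE/= in_itv/= => /andP[_ yx].
  by rewrite /w yx EFinM.
have -> : (\int[leb]_(y in `[x, b[) (w y * dphi y)%:E =
    \int[leb]_(y in `]x, b[) (u y * dphi y)%:E)%E.
  rewrite -integral_itv_obnd_cbnd; last first.
    apply: measurable_funS (measurable_int leb iw) => // y /=; rewrite !in_itv/=.
    by move=> /andP[xy ->]; rewrite (lt_trans ax xy).
  apply: eq_integral => y; rewrite inE/= in_itv/= => /andP[xy _].
  by rewrite /w ltNge (ltW xy).
rewrite right_piece charge_integral_crestr//; last 2 first.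
- exact: continuous_measurable_on.
- exact: continuous_bounded_on.
have bphi (D : set mR) : D `<=` `]a, b[ -> [bounded phi y | y in D].
  exact: bounded_subset (continuous_bounded_on a b cphi).
have mxA : measurable ([set x] `&` A)%classic by exact: measurableI.
rewrite IAE charge_integralU//; last 3 first.
- rewrite disj_set2E; apply/eqP/seteqP; split => // y [] /=; rewrite !in_itv/=.
  by move=> /andP[xy _] [yx _]; rewrite yx ltxx in xy.
- by apply: continuous_measurable_on => //; exact: measurableU.
- by apply: bphi; rewrite -IAE; exact: subIsetl.
have fJ : charge_integral Du `]x, b[ (EFin \o phi) \is a fin_num.
  apply: charge_integral_fin_num => //; first exact: continuous_measurable_on.
  apply: bphi => y /=; rewrite !in_itv/= => /andP[xy ->].
  by rewrite (lt_trans ax xy).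
have -> : charge_integral Du ([set x] `&` A)%classic (EFin \o phi) =
    ((l - k) * phi x)%:E.
  have [xA|xA] := boolP (x \in A).
    have xAE : ([set x] `&` A)%classic = [set x].
      by apply/setIidPl => _ ->; rewrite inE in xA.
    by rewrite xAE charge_integral_set1// -xAE DuxA mulrC EFinM.
  (* For an open cut the restricted charge has no atom at x, and [DuxA] forces l = k. *)
  have xA0 : ([set x] `&` A)%classic = set0.
    by apply/seteqP; split => // y [-> Ax]; move: xA; rewrite notin_setE; apply.
  move: DuxA; rewrite xA0 charge0 => -[<-]; rewrite mul0r.
  by rewrite /charge_integral !integral_set0 sube0.
move: fJ; case: (charge_integral _ _ _) => [q| |]// _.
by rewrite -!EFinN -!EFinD; congr _%:E; ring.
Qed.

End weak_derivative_gluing.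

(** * Complements, subintervals and translations *)

Section weak_derivative_operations.
Context {R : realType}.
Implicit Types (a b x y k l : R) (u phi w : R -> R).
Local Notation mR := (measurableTypeR R).
Local Notation leb := (@lebesgue_measure R).
Local Notation charge_R := (charge (measurableTypeR R) R).

(** Linearity: Du minus its restriction to A is its restriction to the complement, and the constant
    k disappears because the derivative of a test function has integral 0. It spares a second gluing
    argument, for the piece that is constant to the right. *)
Lemma weak_derivative_complement a b u w k (Du : charge_R) (A : set mR)
    (mA : measurable A) (mAc : measurable (~` A)) :
  a < b ->
  leb.-integrable `]a, b[ (EFin \o u) -> leb.-integrable `]a, b[ (EFin \o w) ->
  weak_derivative a b u Du -> weak_derivative a b w (crestr Du mA) ->
  weak_derivative a b (fun y => u y + k - w y) (crestr Du mAc).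
Proof.
move=> ab iu iw wu ww phi tphi.
have mI : measurable (`]a, b[%classic : set mR) by exact: measurable_itv.
have cphi : continuous phi by have [dphi1 _ _] := tphi; exact: derivable_continuous.
have total := test_function_derivative_integral tphi ab.
rewrite (test_function_endpoint tphi) ?lexx ?orbT// in total.
have := wu _ tphi; have := ww _ tphi; move: total.
have [dphi [-> Dphi cdphi]] := test_function_derivative tphi.
move=> total wE uE.
have iuphi := integrable_mul_continuous iu cdphi.
have iwphi := integrable_mul_continuous iw cdphi.
have iphi := integrable_continuous a b cdphi.
have ikphi := integrableZl mI k iphi.
have -> : (\int[leb]_(y in `]a, b[) ((u y + k - w y) * dphi y)%:E =
    \int[leb]_(y in `]a, b[) (u y * dphi y)%:E - \int[leb]_(y in `]a, b[) (w y * dphi y)%:E)%E.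
  transitivity (\int[leb]_(y in `]a, b[) (u y * dphi y)%:E +
      \int[leb]_(y in `]a, b[) (k%:E * (dphi y)%:E) -
      \int[leb]_(y in `]a, b[) (w y * dphi y)%:E)%E; last first.
    by rewrite integralZl// total mule0 adde0.
  rewrite -integralD//; rewrite -integralB//; last exact: integrableD.
  apply: eq_integral => y _ /=; rewrite -EFinM -!EFinD -?EFinB; congr _%:E; ring.
have mphi := continuous_measurable_on mI cphi.
have bphi := continuous_bounded_on a b cphi.
have mIA : measurable (`]a, b[ `&` A)%classic by exact: measurableI.
have mIAc : measurable (`]a, b[ `&` ~` A)%classic by exact: measurableI.
rewrite uE wE !charge_integral_crestr//.
have IE : `]a, b[%classic = (`]a, b[ `&` A `|` `]a, b[ `&` ~` A)%classic.
  by rewrite -setIUr setUv setIT.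
have fin (D : set mR) : measurable D -> D `<=` `]a, b[ ->
    charge_integral Du D (EFin \o phi) \is a fin_num.
  move=> mD DI; apply: charge_integral_fin_num => //.
    exact: continuous_measurable_on.
  exact: bounded_subset DI.
rewrite {1}IE charge_integralU//; last 3 first.
- by rewrite disj_set2E setIACA setICr setI0.
- by rewrite -IE.
- by rewrite -IE.
have := fin _ mIA (@subIsetl _ _ _); have := fin _ mIAc (@subIsetl _ _ _).
case: (charge_integral _ _ _) => [p| |]//; case: (charge_integral _ _ _) => [q| |]// _ _.
by rewrite -?EFinD -?EFinN -?EFinD; congr _%:E; ring.
Qed.

Lemma test_function_derivative_eq0 a b phi y : test_function a b phi ->
  (y <= a) || (b <= y) -> derive1 phi y = 0.
Proof.
move=> tphi yab; have [_ _ [c [d [ac db phi0]]]] := tphi.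
rewrite derive1E (@near_eq_derive _ _ _ _ (cst 0)) ?derive_cst//.
have [yc|dy] : y < c \/ d < y.
  by case/orP: yab => yab; [left; exact: le_lt_trans ac|right; exact: lt_le_trans yab].
  by apply: filterS (lt_nbhsl yc) => z zc; rewrite phi0// in_itv/= leNgt zc.
by apply: filterS (lt_nbhsr dy) => z zd; rewrite phi0// in_itv/= (leNgt z) zd andbF.
Qed.

Lemma test_function_widen a b a' b' phi : a <= a' -> b' <= b ->
  test_function a' b' phi -> test_function a b phi.
Proof.
move=> aa' b'b [dphi cphi' [c [d [ac db phi0]]]]; split=> //.
by exists c, d; rewrite (le_lt_trans aa')// (lt_le_trans db).
Qed.

(** A test function on the smaller interval vanishes outside it together with its derivative, so
    neither integral changes. *)
Lemma weak_derivative_subitv a b a' b' u (Du : charge_R) : a <= a' -> b' <= b ->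
  weak_derivative a b u Du -> weak_derivative a' b' u Du.
Proof.
move=> aa' b'b wu phi tphi; have := wu _ (test_function_widen aa' b'b tphi).
have out y : y \notin `]a', b'[ -> (y <= a') || (b' <= y).
  by rewrite in_itv/= negb_and -!leNgt.
have in_ y : y \in `]a', b'[ -> y \in `]a, b[.
  by rewrite !in_itv/= => /andP[ay yb]; rewrite (le_lt_trans aa' ay) (lt_le_trans yb b'b).
have -> : (\int[leb]_(y in `]a, b[) (u y * derive1 phi y)%:E =
    \int[leb]_(y in `]a', b'[) (u y * derive1 phi y)%:E)%E.
  rewrite [LHS]integral_mkcond [RHS]integral_mkcond; apply: eq_integral => y _.
  rewrite !patchE !mem_setE; have [/in_ -> //|/out yab] := boolP (y \in `]a', b'[).
  by rewrite (test_function_derivative_eq0 tphi yab) mulr0; case: ifP.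
have chargeE : forall m : {measure set mR -> \bar R},
    (\int[m]_(y in `]a, b[) (phi y)%:E = \int[m]_(y in `]a', b'[) (phi y)%:E)%E.
  move=> m; rewrite [LHS]integral_mkcond [RHS]integral_mkcond; apply: eq_integral => y _.
  rewrite !patchE !mem_setE; have [/in_ -> //|/out yab] := boolP (y \in `]a', b'[).
  by rewrite (test_function_endpoint tphi yab); case: ifP.
by move=> ->; rewrite /charge_integral !chargeE.
Qed.

Definition translate_by a : mR -> mR := fun y => y - a.

Lemma measurable_translate_by a : measurable_fun setT (translate_by a).
Proof. by apply: continuous_measurable_fun => y; apply: cvgB; [exact: cvg_id|exact: cvg_cst]. Qed.

Lemma preimage_translate_by a (B B' : bool) (s t : R) :
  translate_by a @^-1` [set` Interval (BSide B s) (BSide B' t)] =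
  [set` Interval (BSide B (a + s)) (BSide B' (a + t))].
Proof.
apply/seteqP; split => y; rewrite /translate_by /= !in_itv/=.
  by case: B; case: B' => /= /andP[? ?]; apply/andP; split; lra.
by case: B; case: B' => /= /andP[? ?]; apply/andP; split; lra.
Qed.

Lemma lebesgue_measure_translate_by a (A : set mR) : measurable A ->
  leb A = leb (translate_by a @^-1` A).
Proof.
move=> mA; have mT := measurable_translate_by a.
unshelve apply: (@lebesgue_measure_unique R (pushforward leb (translate_by a))) mA => //.
move=> _ [[s t] _ <-] /=; rewrite /pushforward preimage_translate_by.
rewrite !lebesgue_measure_itv/= !lte_fin ltrD2l; case: ifP => // _.
by rewrite -!EFinB; congr _%:E; lra.
Qed.

Lemma integral_translate_by a (D : set mR) (f : R -> \bar R) :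
  measurable D -> measurable_fun D (f : mR -> \bar R) ->
  (\int[leb]_(t in D) f t = \int[leb]_(y in translate_by a @^-1` D) f (y - a)%R)%E.
Proof.
move=> mD mf; have mT := measurable_translate_by a.
rewrite -(integral_pushforward_on mT leb mD mf).
by apply: eq_measure_integral => A mA _; exact: (lebesgue_measure_translate_by a mA).
Qed.

End weak_derivative_operations.

(** * Invariance under translation *)

Section translation.
Context {R : realType}.
Implicit Types (a b x y t k l L : R) (u phi theta w f P : R -> R).
Local Notation mR := (measurableTypeR R).
Local Notation leb := (@lebesgue_measure R).
Local Notation charge_R := (charge (measurableTypeR R) R).

Lemma right_cvg_translate u a t l : u y @[y --> (t + a)^'+] --> l ->
  u (y + a) @[y --> t^'+] --> l.
Proof.
move=> ul; apply/cvgrPdist_le => e e0; move/cvgrPdist_le/(_ _ e0): ul => [d /= d0 ud].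
exists d => //= y; rewrite /ball/= => ty yt; apply: ud => /=; last by rewrite ltrD2r.
by rewrite /ball/= opprD addrACA subrr addr0.
Qed.

Lemma left_cvg_translate u a t l : u y @[y --> (t + a)^'-] --> l ->
  u (y + a) @[y --> t^'-] --> l.
Proof.
move=> ul; apply/cvgrPdist_le => e e0; move/cvgrPdist_le/(_ _ e0): ul => [d /= d0 ud].
exists d => //= y; rewrite /ball/= => ty yt; apply: ud => /=; last by rewrite ltrD2r.
by rewrite /ball/= opprD addrACA subrr addr0.
Qed.

Lemma variation_dominated_translate a L u P M :
  variation_dominated a (a + L) u P M ->
  variation_dominated 0 L (fun t => u (t + a)) (fun t => P (t + a)) M.
Proof.
move=> [bP dP]; split=> [s s0 sL|s t s0 st tL]; first by apply: bP; lra.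
by apply: dP; lra.
Qed.

Lemma pointwise_variation_translate a L u : 0 < L ->
  (pointwise_variation a (a + L)%R u < +oo)%E ->
  (pointwise_variation 0 L (fun t => u (t + a)%R) < +oo)%E.
Proof.
move=> L0 uoo; have aL : a < a + L by rewrite ltrDl.
have [P [M dom]] := pointwise_variation_dominated aL uoo.
exact: variation_dominated_pointwise (variation_dominated_translate dom).
Qed.

Lemma rtrace_translate a L u t : (pointwise_variation a (a + L)%R u < +oo)%E ->
  0 <= t -> t < L -> rtrace 0 L (fun s => u (s + a)) t = rtrace a (a + L) u (t + a).
Proof.
move=> uoo t0 tL; have L0 := le_lt_trans t0 tL.
have goodr := good_representative_refl (pointwise_variation_translate L0 uoo).
apply: (rtraceE t0 tL goodr); apply: right_cvg_translate.
by apply: rtrace_cvg => //; lra.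
Qed.

Lemma ltrace_translate a L u t : (pointwise_variation a (a + L)%R u < +oo)%E ->
  0 < t -> t <= L -> ltrace 0 L (fun s => u (s + a)) t = ltrace a (a + L) u (t + a).
Proof.
move=> uoo t0 tL; have L0 := lt_le_trans t0 tL.
have goodr := good_representative_refl (pointwise_variation_translate L0 uoo).
apply: (ltraceE t0 tL goodr); apply: left_cvg_translate.
by apply: ltrace_cvg => //; lra.
Qed.

Lemma jump_translate a L u t : (pointwise_variation a (a + L)%R u < +oo)%E ->
  t \in `]0, L[ -> jump 0 L (fun s => u (s + a)) t = jump a (a + L) u (t + a).
Proof.
move=> uoo; rewrite in_itv/= => /andP[t0 tL].
have rE := rtrace_translate uoo (ltW t0) tL.
have lE := ltrace_translate uoo t0 (ltW tL).
by rewrite /jump rE lE.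
Qed.

Lemma jump_set_translate a L u t : (pointwise_variation a (a + L)%R u < +oo)%E ->
  jump_set 0 L (fun s => u (s + a)) t <-> jump_set a (a + L) u (t + a).
Proof.
move=> uoo; have E : (t + a \in `]a, a + L[) = (t \in `]0, L[).
  by rewrite !in_itv/=; apply/idP/idP => /andP[? ?]; apply/andP; split; lra.
rewrite /jump_set /= E; split=> -[tL].
  by rewrite jump_translate.
by rewrite -jump_translate.
Qed.

Lemma measurable_translate (A : set mR) a u :
  measurable A -> measurable_fun (translate_by a @^-1` A) (u : mR -> R) ->
  measurable_fun A ((fun t => u (t + a)) : mR -> R).
Proof.
move=> mA mu; have mTA : measurable (translate_by a @^-1` A).
  by rewrite -[X in measurable X]setTI; exact: measurable_translate_by.
apply: (@measurable_comp _ _ _ _ _ _ (translate_by a @^-1` A) u A (fun t : mR => t + a)) => //.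
  by move=> _ [t At <-]; rewrite /translate_by /= addrK.
by apply: continuous_measurable_on => // t; apply: cvgD; [exact: cvg_id|exact: cvg_cst].
Qed.

Lemma integral_translate a (A : set mR) u : measurable A ->
  measurable_fun (translate_by a @^-1` A) (u : mR -> R) ->
  (\int[leb]_(t in A) (u (t + a)%R)%:E =
   \int[leb]_(y in translate_by a @^-1` A) (u y)%:E)%E.
Proof.
move=> mA mu; rewrite (@integral_translate_by _ a A (fun t => (u (t + a))%:E)) //.
  by apply: eq_integral => y _; rewrite subrK.
by apply/measurable_EFinP; exact: measurable_translate.
Qed.

Lemma preimage_translate_oo a L : translate_by a @^-1` `]0, L[ = `]a, a + L[%classic.
Proof. by rewrite preimage_translate_by addr0. Qed.

Lemma integrable_translate a L u : leb.-integrable `]a, a + L[ (EFin \o u) ->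
  leb.-integrable `]0, L[ (EFin \o (fun t => u (t + a))).
Proof.
move=> /integrableP[mu uoo].
have mI : measurable (`]0, L[%classic : set mR) by exact: measurable_itv.
have mu' : measurable_fun (translate_by a @^-1` `]0, L[) (u : mR -> R).
  by rewrite preimage_translate_oo; exact/measurable_EFinP.
apply/integrableP; split.
  by apply/measurable_EFinP; exact: measurable_translate.
have E : (\int[leb]_(t in `]0%R, L[) (`|u (t + a)%R|%R)%:E =
    \int[leb]_(y in translate_by a @^-1` `]0%R, L[) (`|u y|%R)%:E)%E.
  by apply: (@integral_translate a _ (fun y => `|u y|)) => //; exact: measurableT_comp.
by apply: le_lt_trans uoo; rewrite -preimage_translate_oo le_eqVlt; apply/orP; left; apply/eqP.
Qed.

Lemma test_function_translate a L phi : test_function 0 L phi ->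
  test_function a (a + L) (fun y => phi (y - a)) /\
  derive1 (fun y => phi (y - a)) = (fun y => derive1 phi (y - a)).
Proof.
move=> tphi; have [_ _ [c [d [c0 dL phi0]]]] := tphi.
have [dphi [-> Dphi cdphi]] := test_function_derivative tphi.
have cT : continuous (fun y : R => y - a).
  by move=> y; apply: cvgB; [exact: cvg_id|exact: cvg_cst].
apply: is_derive_test_function.
- move=> y; have /is_derive1_caratheodory[h [hE ch hy]] := Dphi (y - a).
  apply/is_derive1_caratheodory; exists (fun z => h (z - a)); split=> //.
    by move=> z; rewrite hE; congr (_ * _); ring.
  by apply: (@continuous_comp _ _ _ (fun y : R => y - a) h) => //; exact: cT.
- move=> y; apply: (@continuous_comp _ _ _ (fun y : R => y - a) dphi); first exact: cT.
  exact: cdphi.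
- exists (c + a), (d + a); split; [lra|lra|] => y yn; apply: phi0.
  apply: contra yn; rewrite !in_itv/= => /andP[? ?]; apply/andP; split; lra.
Qed.

Lemma weak_derivative_translate a L u (Du Du' : charge_R) :
  measurable_fun `]a, a + L[ (u : mR -> R) ->
  (forall A : set mR, Du' A = Du (translate_by a @^-1` A)) ->
  weak_derivative a (a + L) u Du -> weak_derivative 0 L (fun t => u (t + a)) Du'.
Proof.
move=> mu Du'E wu phi tphi.
have mI : measurable (`]0, L[%classic : set mR) by exact: measurable_itv.
have mJ : measurable (`]a, a + L[%classic : set mR) by exact: measurable_itv.
have cphi : continuous phi by have [dphi1 _ _] := tphi; exact: derivable_continuous.
rewrite (charge_integral_pushforward (measurable_translate_by a) (nu := Du))//; last 2 first.
- exact: continuous_measurable_on.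
- exact: continuous_bounded_on.
have [tphi' dphi'] := test_function_translate a tphi.
rewrite preimage_translate_oo -[X in (- charge_integral _ _ X)%E]/(EFin \o (fun y => phi (y - a))).
have := wu _ tphi'; rewrite dphi'.
have [dphi [-> Dphi cdphi]] := test_function_derivative tphi.
move=> <-; have E := @integral_translate a _ (fun y => u y * dphi (y - a)) mI.
rewrite preimage_translate_oo in E.
rewrite -E.
  by apply: eq_integral => t _; rewrite addrK.
apply: measurable_funM => //; apply: continuous_measurable_on => // y.
apply: (@continuous_comp _ _ _ (fun y : R => y - a) dphi); last exact: cdphi.
by apply: cvgB; [exact: cvg_id|exact: cvg_cst].
Qed.

End translation.

Section total_variation_translation.
Context {R : realType}.
Implicit Types (a b x y t k l L : R) (u phi theta w f P : R -> R).
Local Notation mR := (measurableTypeR R).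
Local Notation leb := (@lebesgue_measure R).
Local Notation charge_R := (charge (measurableTypeR R) R).

Lemma admissible_phi_measurable phi theta (D : set mR) f :
  admissible_densities phi theta -> measurable D -> measurable_fun D (f : mR -> R) ->
  measurable_fun D ((fun y => phi `|f y|) : mR -> R).
Proof.
move=> [[_ _ nd_phi _ _] _] mD mf.
(* [phi] is controlled only on [0, +oo[; precomposing with the maximum with 0 gives a function
   monotone on the whole line, with the same values at absolute values. *)
have nd : {homo (fun t => phi (Num.max 0 t)) : s t / s <= t}.
  by move=> s t st; apply: nd_phi; rewrite ?in_itv/= ?andbT;
    have [] := leP 0 s; have [] := leP 0 t; lra.
have mphi : measurable_fun setT (fun t => phi (Num.max 0 t)).
  exact: nondecreasing_measurable.
have -> : (fun y => phi `|f y|) = (fun t => phi (Num.max 0 t)) \o (fun y => `|f y|).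
  by apply/funext => y /=; rewrite max_r.
apply: (@measurableT_comp _ _ _ mR R R (fun t => phi (Num.max 0 t))) => //.
exact: measurableT_comp.
Qed.

Lemma bv_decomposition_translate a L u f (Dc Dj : charge_R) :
  (pointwise_variation a (a + L)%R u < +oo)%E ->
  measurable_fun `]a, a + L[ (u : mR -> R) ->
  bv_decomposition a (a + L) u f Dc Dj ->
  exists Dc' Dj' : charge_R,
    bv_decomposition 0 L (fun t => u (t + a)) (fun t => f (t + a)) Dc' Dj' /\
    forall A : set mR, measurable A -> Dc' A = Dc (translate_by a @^-1` A).
Proof.
move=> uoo mu [[Du wu DuE] intf [[N [mN N0 DcN]] Dc1] [Dj0 Dj1]].
have mT := measurable_translate_by a.
have mTA (A : set mR) : measurable A -> measurable (translate_by a @^-1` A).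
  by move=> mA; rewrite -[X in measurable X]setTI; exact: mT.
have TA (A : set R) : A `<=` `]0, L[ -> translate_by a @^-1` A `<=` `]a, a + L[.
  by move=> AI y /AI; rewrite -preimage_translate_oo.
have T1 t : translate_by a @^-1` [set t] = [set t + a].
  apply/seteqP; split=> y; rewrite /translate_by /=.
    by move=> <-; rewrite subrK.
  by move=> ->; rewrite addrK.
have inT t : t \in `]0, L[ -> t + a \in `]a, a + L[.
  by rewrite !in_itv/= => /andP[? ?]; apply/andP; split; lra.
have [Du' Du'E] := charge_pushforward_exists mT Du.
have [Dc' Dc'E] := charge_pushforward_exists mT Dc.
have [Dj' Dj'E] := charge_pushforward_exists mT Dj.
exists Dc', Dj'; split; last by move=> A mA; exact: Dc'E.
split.
- exists Du'; first exact: weak_derivative_translate wu.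
  move=> A mA AI; rewrite Du'E DuE; [|exact: mTA|exact: TA].
  rewrite Dc'E Dj'E; congr (_ + _ + _)%E.
  rewrite (integral_translate (a := a) mA)//.
  apply: (measurable_funS _ (TA _ AI)); first exact: measurable_itv.
  by apply/measurable_EFinP; exact: (measurable_int leb intf).
- exact: integrable_translate.
- split.
    exists ((fun t : mR => t + a) @^-1` N); split.
    + have : measurable_fun setT (fun t : mR => t + a : mR).
        apply: continuous_measurable_on => // t.
        by apply: cvgD; [exact: cvg_id|exact: cvg_cst].
      by move=> mta; rewrite -[X in measurable X]setTI; exact: mta.
    + have mSN : measurable ((fun t : mR => t + a) @^-1` N).
        have : measurable_fun setT (fun t : mR => t + a : mR).
          apply: continuous_measurable_on => // t.
          by apply: cvgD; [exact: cvg_id|exact: cvg_cst].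
        by move=> mta; rewrite -[X in measurable X]setTI; exact: mta.
      rewrite (lebesgue_measure_translate_by a mSN) -[RHS]N0; congr (leb _).
      by apply/seteqP; split => y; rewrite /translate_by/= subrK.
    + move=> A mA AI AN; rewrite Dc'E DcN//; [exact: mTA|exact: TA|].
      apply/seteqP; split=> // y [Ay Ny].
      have : (A `&` ((fun t : mR => t + a) @^-1` N)) (y - a) by split=> //=; rewrite subrK.
      by rewrite AN.
  by move=> t tI; rewrite Dc'E T1 Dc1// inT.
- split.
    move=> A mA AI AJ; rewrite Dj'E Dj0//; [exact: mTA|exact: TA|].
    apply/seteqP; split=> // y [Ay Jy].
    have : (A `&` jump_set 0 L (fun t => u (t + a))) (y - a).
      split=> //; apply: (proj2 (jump_set_translate (y - a) uoo)).
      by rewrite subrK.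
    by rewrite AJ.
  move=> t Jt; rewrite Dj'E T1 Dj1; last exact/jump_set_translate.
  by rewrite jump_translate//; case: Jt.
Qed.

(** One inequality suffices, because the infimum E only has to be bounded above by the energy of a
    piece of g: decompositions are carried from ]a, a + L[ to ]0, L[. *)
Lemma TV_translate phi theta a L u : admissible_densities phi theta ->
  (pointwise_variation a (a + L)%R u < +oo)%E ->
  measurable_fun `]a, a + L[ (u : mR -> R) ->
  (TV phi theta 0 L (fun t => u (t + a)%R) <= TV phi theta a (a + L)%R u)%E.
Proof.
move=> adm uoo mu; apply: le_ereal_inf_tmp => _ [f [Dc [Dj [decomp ->]]]].
have [_ intf _ _] := decomp.
have mI : measurable (`]0, L[%classic : set mR) by exact: measurable_itv.
have mJ : measurable (`]a, a + L[%classic : set mR) by exact: measurable_itv.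
have [Dc' [Dj' [decomp' Dc'E]]] := bv_decomposition_translate uoo mu decomp.
apply: (@le_trans _ _ (\int[leb]_(x in `]0%R, L[) (phi `|f (x + a)%R|)%:E
   + variation_measure Dc' `]0%R, L[
   + \esum_(x in jump_set 0 L (fun t => u (t + a)%R))
       (theta `|jump 0 L (fun t => u (t + a)%R) x|)%:E)%E).
  by apply: ereal_inf_lbound; exists (fun t => f (t + a)), Dc', Dj'.
have mf : measurable_fun `]a, a + L[ (f : mR -> R).
  by apply/measurable_EFinP; exact: (measurable_int leb intf).
apply: leeD; first apply: leeD.
- have := @integral_translate _ a _ (fun y => phi `|f y|) mI.
  rewrite preimage_translate_oo => -> //.
  exact: admissible_phi_measurable adm _ _.
(* The image of the variation of [Dc] is a measure dominating the absolute value of [Dc'] on every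
   measurable set, hence dominating its variation. *)
- have [m mE] : exists m : {measure set mR -> \bar R}, forall A,
      m A = variation_measure Dc (translate_by a @^-1` A).
    unshelve eexists (pushforward (charge_variation (hahnPN Dc)) (translate_by a) :
      {measure set mR -> \bar R}) => //.
    exact: measurable_translate_by.
  rewrite -preimage_translate_oo -mE; apply: variation_measure_le => // A mA _.
  rewrite Dc'E// mE; apply: abse_le_variation_measure.
  by rewrite -[X in measurable X]setTI; exact: measurable_translate_by.
- rewrite (@reindex_esum R _ _ (jump_set 0 L (fun t => u (t + a)))
    (jump_set a (a + L) u) (fun t => t + a)).
    rewrite le_eqVlt; apply/orP; left; apply/eqP; apply: eq_esum => t [tI _].
    by rewrite (jump_translate uoo tI).
  split=> [t|s t _ _|y Jy]; first exact: (proj1 (jump_set_translate _ uoo)).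
    exact: addIr.
  exists (y - a); last by rewrite subrK.
  by apply/(jump_set_translate _ uoo); rewrite subrK.
Qed.

End total_variation_translation.

(** * Cutting a function at a one-sided limit *)

Section decomposition_restriction.
Context {R : realType}.
Implicit Types (a b x y t k l L : R) (u phi theta w f P : R -> R).
Local Notation mR := (measurableTypeR R).
Local Notation leb := (@lebesgue_measure R).
Local Notation charge_R := (charge (measurableTypeR R) R).

(** The energy attached to one decomposition; [TV] is the infimum of these values. *)
Definition TV_energy phi theta a b u f (Dc : charge_R) : \bar R :=
  (\int[leb]_(x in `]a, b[) (phi `|f x|)%:E + variation_measure Dc `]a, b[
   + \esum_(x in jump_set a b u) (theta `|jump a b u x|)%:E)%E.

(** All or nothing at each point: this is the precise sense in which no jump is split. *)
Definition jump_restricts a b u a' b' w (A : set R) : Prop :=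
  forall y, y \in `]a', b'[ -> jump a' b' w y = if y \in A then jump a b u y else 0.

Lemma jump_set_restricts a b u a' b' w A : a <= a' -> b' <= b ->
  jump_restricts a b u a' b' w A -> jump_set a' b' w `<=` jump_set a b u `&` A.
Proof.
move=> aa' b'b jw y [yI]; rewrite jw//; case: ifPn => [yA|]; last by rewrite eqxx.
move=> jy; split; last by rewrite inE in yA.
split=> //; move: yI; rewrite !in_itv/= => /andP[ay yb].
by rewrite (le_lt_trans aa' ay) (lt_le_trans yb b'b).
Qed.

(** [DuE] is stated separately because [bv_decomposition] hides its derivative behind an
    existential, whereas here it must be the same [Du] whose restriction differentiates w. *)
Lemma bv_decomposition_restrict a b u f (Du Dc Dj : charge_R) a' b' w (A : set mR)
    (mA : measurable A) : a <= a' -> b' <= b ->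
  (forall E : set mR, measurable E -> E `<=` `]a, b[ ->
     Du E = (\int[leb]_(x in E) (f x)%:E + Dc E + Dj E)%E) ->
  bv_decomposition a b u f Dc Dj ->
  weak_derivative a' b' w (crestr Du mA) ->
  jump_restricts a b u a' b' w A ->
  bv_decomposition a' b' w (f \_ A) (crestr Dc mA) (crestr Dj mA).
Proof.
move=> aa' b'b DuE [_ intf [[N [mN N0 DcN]] Dc1] [Dj0 Dj1]] ww jw.
have mI : measurable (`]a, b[%classic : set mR) by exact: measurable_itv.
have mI' : measurable (`]a', b'[%classic : set mR) by exact: measurable_itv.
have II' : (`]a', b'[%classic : set R) `<=` `]a, b[.
  move=> y /=; rewrite !in_itv/= => /andP[ay yb].
  by rewrite (le_lt_trans aa' ay) (lt_le_trans yb b'b).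
have sub (E : set R) : E `<=` `]a', b'[ -> E `&` A `<=` `]a, b[.
  by move=> EI y [/EI /II'].
split.
- exists (crestr Du mA) => // E mE EI; have mEA : measurable (E `&` A) by exact: measurableI.
  rewrite /= /crestr DuE//; last exact: sub.
  congr (_ + _ + _)%E; rewrite integral_mkcondr; apply: eq_integral => y _.
  by rewrite !patchE; case: ifP.
- have -> : EFin \o (f \_ A) = (EFin \o f) \_ A.
    by apply/funext => y; rewrite /= !patchE; case: ifP.
  apply/integrable_restrict => //.
  by apply: (integrableS mI) => //; [exact: measurableI|exact: sub].
- split.
    exists N; split=> // E mE EI EN; rewrite /= /crestr DcN//; [exact: measurableI|exact: sub|].
    by apply/seteqP; split=> // y [[Ey Ay] Ny]; rewrite -EN.
  move=> y yI; rewrite /= /crestr; have [yA|yA] := boolP (y \in A).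
    rewrite (_ : [set y] `&` A = [set y]) ?Dc1//; first exact: (II' _ yI).
    by apply/setIidPl => _ ->; rewrite inE in yA.
  rewrite (_ : [set y] `&` A = set0) ?charge0//.
  by apply/seteqP; split=> // _ [-> Ay]; move: yA; rewrite notin_setE; apply.
- split.
    move=> E mE EI EJ; rewrite /= /crestr Dj0//; [exact: measurableI|exact: sub|].
    apply/seteqP; split=> // y [[Ey Ay] [yI Jy]]; rewrite -EJ; split=> //.
    split; first exact: (EI _ Ey).
    by rewrite jw ?mem_set//; exact: (EI _ Ey).
  move=> y Jy; have [Juy Ay] := jump_set_restricts aa' b'b jw Jy.
  rewrite /= /crestr (_ : [set y] `&` A = [set y]); last first.
    by apply/setIidPl => _ ->.
  by rewrite Dj1// jw ?mem_set//; case: Jy.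
Qed.

Lemma variation_measure_crestr (nu : charge_R) (A D : set mR) (mA : measurable A) :
  measurable D ->
  (variation_measure (crestr nu mA) D <= variation_measure nu (D `&` A)%classic)%E.
Proof.
move=> mD; have := @variation_measure_le _ _ R (crestr nu mA)
  (mrestr (charge_variation (hahnPN nu)) mA) D mD.
apply => E mE _; apply: abse_le_variation_measure.
exact: measurableI.
Qed.

Lemma esum_subset (D E : set R) (F : R -> \bar R) : D `<=` E ->
  (forall x, E x -> 0 <= F x)%E ->
  (\esum_(x in D) F x <= \esum_(x in E) F x)%E.
Proof.
move=> DE F0; rewrite [leRHS](esumID D)// (setIidr DE) leeDl//.
by apply: esum_ge0 => x [Ex _]; exact: F0.
Qed.

(** Each of the three terms is additive over A and its complement. Equality may fail only because
    the two pieces may live on smaller intervals, and each term is monotone in the domain. *)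
Lemma TV_energy_split phi theta a b u f (Dc : charge_R) a1 b1 a2 b2 w1 w2
    (A : set mR) (mA : measurable A) (mAc : measurable (~` A)) :
  admissible_densities phi theta ->
  measurable_fun `]a, b[ (f : mR -> R) ->
  a <= a1 -> b1 <= b -> a <= a2 -> b2 <= b ->
  jump_restricts a b u a1 b1 w1 A -> jump_restricts a b u a2 b2 w2 (~` A) ->
  (TV_energy phi theta a1 b1 w1 (f \_ A) (crestr Dc mA) +
   TV_energy phi theta a2 b2 w2 (f \_ (~` A)) (crestr Dc mAc) <=
   TV_energy phi theta a b u f Dc)%E.
Proof.
move=> adm mf aa1 b1b aa2 b2b j1 j2; have [[phi_ge0 phi0 _ _ _] [theta_ge0 _ _ _ _]] := adm.
have mI s t : measurable (`]s, t[%classic : set mR) by exact: measurable_itv.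
have sub s t : a <= s -> t <= b -> (`]s, t[%classic : set R) `<=` `]a, b[.
  move=> as_ tb y /=; rewrite !in_itv/= => /andP[sy yt].
  by rewrite (le_lt_trans as_ sy) (lt_le_trans yt tb).
have disjA (D E : set mR) : [disjoint D `&` A & E `&` ~` A].
  by rewrite disj_set2E setIACA setICr setI0.
have mphif := admissible_phi_measurable adm (mI a b) mf.
rewrite /TV_energy; set I1 := integral _ _ _; set V1 := variation_measure _ _.
set S1 := \esum_(i in _) _; set I2 := integral _ _ _; set V2 := variation_measure _ _.
set S2 := \esum_(i in _) _.
have -> : (I1 + V1 + S1 + (I2 + V2 + S2) = (I1 + I2) + (V1 + V2) + (S1 + S2))%E.
  by rewrite addeACA; congr (_ + _)%E; rewrite addeACA.
apply: leeD; first apply: leeD.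
- have IE s t (B : set mR) : (\int[leb]_(x in `]s, t[) (phi `|(f \_ B) x|)%:E =
      \int[leb]_(x in `]s, t[ `&` B) (phi `|f x|)%:E)%E.
    rewrite integral_mkcondr; apply: eq_integral => y _.
    by rewrite !patchE; case: ifP => // _; rewrite normr0 phi0.
  rewrite /I1 /I2 !IE -ge0_integral_setU//; last 4 first.
  + exact: measurableI.
  + exact: measurableI.
  + apply/measurable_EFinP; apply: measurable_funS mphif => // y [] [].
      by move=> /(sub _ _ aa1 b1b).
    by move=> /(sub _ _ aa2 b2b).
  + by move=> y _; rewrite lee_fin phi_ge0.
  apply: ge0_subset_integral => //.
  + by apply: measurableU; exact: measurableI.
  + exact/measurable_EFinP.
  + by move=> y _; rewrite lee_fin phi_ge0.
  + by move=> y [] [] => [/(sub _ _ aa1 b1b)|/(sub _ _ aa2 b2b)].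
- pose m : {measure set mR -> \bar R} := charge_variation (hahnPN Dc).
  apply: (@le_trans _ _ (m (`]a1, b1[ `&` A) + m (`]a2, b2[ `&` ~` A))%E).
    by apply: leeD; exact: variation_measure_crestr.
  rewrite -measureU; [|exact: measurableI|exact: measurableI|]; last first.
    by apply/eqP; rewrite -disj_set2E.
  apply: le_measure; rewrite ?inE//; first by apply: measurableU; exact: measurableI.
  by move=> y [] [] => [/(sub _ _ aa1 b1b)|/(sub _ _ aa2 b2b)].
- have le_S s t w (B : set mR) : a <= s -> t <= b -> jump_restricts a b u s t w B ->
      (\esum_(x in jump_set s t w) (theta `|jump s t w x|)%:E <=
       \esum_(x in jump_set a b u `&` B) (theta `|jump a b u x|)%:E)%E.
    move=> as_ tb jw; have JS := jump_set_restricts as_ tb jw.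
    rewrite (eq_esum (b := fun x => (theta `|jump a b u x|)%:E)); last first.
      by move=> y Jy; have [_ By] := JS _ Jy; rewrite jw ?mem_set//; case: Jy.
    by apply: esum_subset => // y _; rewrite lee_fin theta_ge0.
  rewrite [leRHS](esumID A); last by move=> y _; rewrite lee_fin theta_ge0.
  by apply: leeD; exact: le_S.
Qed.

End decomposition_restriction.

(** * The two pieces of a cut function *)

Section cut.
Context {R : realType}.
Implicit Types (a b x y t k l L : R) (u phi theta w f P : R -> R).
Local Notation mR := (measurableTypeR R).
Local Notation leb := (@lebesgue_measure R).
Local Notation charge_R := (charge (measurableTypeR R) R).

Lemma right_cvg_eq u w y c l : y < c -> (forall z, y < z -> z < c -> w z = u z) ->
  u z @[z --> y^'+] --> l -> w z @[z --> y^'+] --> l.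
Proof.
move=> yc wu; apply: cvg_trans; apply: near_eq_cvg.
apply: filterS2 (nbhs_right_gt y) (nbhs_right_lt yc).
by move=> z yz zc; rewrite wu.
Qed.

Lemma left_cvg_eq u w y c l : c < y -> (forall z, c < z -> z < y -> w z = u z) ->
  u z @[z --> y^'-] --> l -> w z @[z --> y^'-] --> l.
Proof.
move=> yc wu; apply: cvg_trans; apply: near_eq_cvg.
apply: filterS2 (nbhs_left_gt yc) (nbhs_left_lt y).
by move=> z yz zc; rewrite wu.
Qed.

Lemma pointwise_variation_subitv a b b' u : a < b' -> b' <= b ->
  (pointwise_variation a b u < +oo)%E -> (pointwise_variation a b' u < +oo)%E.
Proof.
move=> ab' b'b uoo; have ab := lt_le_trans ab' b'b.
have [P [M [bP dP]]] := pointwise_variation_dominated ab uoo.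
apply: (@variation_dominated_pointwise _ _ _ _ P M); split=> [s as_ sb|s t as_ st tb].
  by apply: bP => //; exact: lt_le_trans b'b.
by apply: dP => //; exact: lt_le_trans b'b.
Qed.

(** With k the supremum S, [const_left x k g] is the competitor u of the overview and
    [const_right x k g] its piece v. *)
Definition const_left x k u : R -> R := fun y => if y < x then k else u y.

Definition const_right x k u : R -> R := fun y => if y < x then u y else k.

Lemma pointwise_variation_const_left a b x k u : a < b ->
  (pointwise_variation a b u < +oo)%E ->
  (pointwise_variation a b (const_left x k u) < +oo)%E.
Proof.
move=> ab uoo; have [P [M dom]] := pointwise_variation_dominated ab uoo.
have [K bu] := variation_dominated_bounded ab dom; have [bP dP] := dom.
have c_in : a < (a + b) / 2 /\ (a + b) / 2 < b by split; lra.
have K0 : 0 <= K by apply: le_trans (bu _ c_in.1 c_in.2).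
have M0 : 0 <= M by apply: le_trans (bP _ c_in.1 c_in.2).
(* Before x the majorant is lowered to - (M + |k| + K). As P >= - M, it then rises by at least |k| +
   K across x, which covers the step from k to a value of u. *)
apply: (@variation_dominated_pointwise _ _ _ _
  (fun y => if y < x then - (M + `|k| + K) else P y) (M + `|k| + K)).
split=> [s as_ sb|s t as_ st tb].
  case: ifP => _; first by rewrite normrN ger0_norm//; do !apply: addr_ge0.
  by apply: le_trans (bP _ as_ sb) _; rewrite -addrA lerDl addr_ge0.
rewrite /const_left; have [tx|xt] := ltP t x.
  by rewrite (le_lt_trans st tx) !subrr normr0.
have [sx|xs] := ltP s x; last exact: dP.
have at_ := lt_le_trans as_ st.
have := bP _ at_ tb; have := bu _ at_ tb; have := ler_norm k; have := ler_norm (- k).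
rewrite normrN !ler_norml => ? ? /andP[? ?] /andP[? ?]; apply/andP; split; lra.
Qed.

Lemma pointwise_variation_const_right a b x k u : a < b ->
  (pointwise_variation a b u < +oo)%E ->
  (pointwise_variation a b (const_right x k u) < +oo)%E.
Proof.
move=> ab uoo; have [P [M dom]] := pointwise_variation_dominated ab uoo.
have [K bu] := variation_dominated_bounded ab dom; have [bP dP] := dom.
have c_in : a < (a + b) / 2 /\ (a + b) / 2 < b by split; lra.
have K0 : 0 <= K by apply: le_trans (bu _ c_in.1 c_in.2).
have M0 : 0 <= M by apply: le_trans (bP _ c_in.1 c_in.2).
(* Symmetric choice: from x on the majorant is raised to M + |k| + K, at least |k| + K above every
   value of P. *)
apply: (@variation_dominated_pointwise _ _ _ _
  (fun y => if y < x then P y else M + `|k| + K) (M + `|k| + K)).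
split=> [s as_ sb|s t as_ st tb].
  case: ifP => _; last by rewrite ger0_norm//; do !apply: addr_ge0.
  by apply: le_trans (bP _ as_ sb) _; rewrite -addrA lerDl addr_ge0.
rewrite /const_right; have [tx|xt] := ltP t x.
  by rewrite (le_lt_trans st tx); exact: dP.
have [sx|xs] := ltP s x; last by rewrite !subrr normr0.
have sb := le_lt_trans st tb.
have := bP _ as_ sb; have := bu _ as_ sb; have := ler_norm k; have := ler_norm (- k).
rewrite normrN !ler_norml => ? ? /andP[? ?] /andP[? ?]; apply/andP; split; lra.
Qed.

Section cut_at.
Variables (a b x : R) (u : R -> R) (B : bool).
Hypotheses (ax : a < x) (xb : x < b) (uoo : (pointwise_variation a b u < +oo)%E).

Let ab : a < b. Proof. exact: lt_trans xb. Qed.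

(** B ties the value to the set. Cutting at the left limit leaves the whole jump at x to
    [const_left], so [cut_set] must contain x; cutting at the right limit leaves it to
    [const_right], so [cut_set] must be open at x. *)
Definition cut_value : R := if B then ltrace a b u x else rtrace a b u x.

Definition cut_set : set mR := [set` Interval (BSide B x) (BLeft b)].

Local Notation k := cut_value.
Local Notation A := cut_set.

Lemma mem_cut_set y : y < b -> (y \in A) = (if B then x <= y else x < y).
Proof. by move=> yb; rewrite /cut_set mem_setE in_itv/= yb andbT; case: B. Qed.

Lemma rtrace_const_left y : x <= y -> y < b ->
  rtrace a b (const_left x k u) y = rtrace a b u y.
Proof.
move=> xy yb; have ay : a <= y by rewrite (le_trans (ltW ax)).
apply: (rtraceE ay yb); first exact/good_representative_refl/pointwise_variation_const_left.
apply: (right_cvg_eq yb _ (rtrace_cvg ay yb uoo)) => z yz zb.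
by rewrite /const_left ltNge (le_trans xy (ltW yz)).
Qed.

Lemma ltrace_const_left y : x < y -> y <= b ->
  ltrace a b (const_left x k u) y = ltrace a b u y.
Proof.
move=> xy yb; have ay : a < y by rewrite (lt_trans ax).
apply: (ltraceE ay yb); first exact/good_representative_refl/pointwise_variation_const_left.
apply: (left_cvg_eq xy _ (ltrace_cvg ay yb uoo)) => z xz zy.
by rewrite /const_left ltNge (ltW xz).
Qed.

Lemma rtrace_const_left_lt y : a <= y -> y < x -> rtrace a b (const_left x k u) y = k.
Proof.
move=> ay yx; apply: (rtraceE ay (lt_trans yx xb)).
  exact/good_representative_refl/pointwise_variation_const_left.
apply: (@right_cvg_eq (cst k) _ y x _ yx); last exact: cvg_cst.
by move=> z _ zx; rewrite /const_left zx.
Qed.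

Lemma ltrace_const_left_le y : a < y -> y <= x -> ltrace a b (const_left x k u) y = k.
Proof.
move=> ay yx; apply: (ltraceE ay (le_trans yx (ltW xb))).
  exact/good_representative_refl/pointwise_variation_const_left.
apply: (@left_cvg_eq (cst k) _ y a _ ay); last exact: cvg_cst.
by move=> z _ zy; rewrite /const_left (lt_le_trans zy yx).
Qed.

Lemma jump_const_left : jump_restricts a b u a b (const_left x k u) A.
Proof.
move=> y; rewrite in_itv/= => /andP[ay yb]; rewrite mem_cut_set// /jump.
have [xy|yx|<-] := ltgtP x y.
- by rewrite rtrace_const_left ?(ltW xy)// ltrace_const_left ?(ltW yb)//; case: B.
- by rewrite rtrace_const_left_lt ?(ltW ay)// ltrace_const_left_le ?(ltW yx)// subrr; case: B.
- rewrite rtrace_const_left// ltrace_const_left_le// /cut_value.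
  by case: B; rewrite ?subrr.
Qed.

Variable b' : R.
Hypotheses (xb' : x < b') (b'b : b' <= b).

Let ab' : a < b'. Proof. exact: lt_trans xb'. Qed.

Let uoo' : (pointwise_variation a b' u < +oo)%E.
Proof. exact: pointwise_variation_subitv uoo. Qed.

Let good : good_representative a b' (const_right x k u) (const_right x k u).
Proof. exact/good_representative_refl/pointwise_variation_const_right. Qed.

Lemma rtrace_const_right y : a <= y -> y < x ->
  rtrace a b' (const_right x k u) y = rtrace a b u y.
Proof.
move=> ay yx; apply: (rtraceE ay (lt_trans yx xb') good).
apply: (right_cvg_eq yx _ (rtrace_cvg ay (lt_trans yx xb) uoo)) => z yz zx.
by rewrite /const_right zx.
Qed.

Lemma ltrace_const_right y : a < y -> y <= x ->
  ltrace a b' (const_right x k u) y = ltrace a b u y.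
Proof.
move=> ay yx; apply: (ltraceE ay (le_trans yx (ltW xb')) good).
apply: (left_cvg_eq ay _ (ltrace_cvg ay (le_trans yx (ltW xb)) uoo)) => z az zy.
by rewrite /const_right (lt_le_trans zy yx).
Qed.

Lemma rtrace_const_right_ge y : x <= y -> y < b' -> rtrace a b' (const_right x k u) y = k.
Proof.
move=> xy yb; apply: (rtraceE (le_trans (ltW ax) xy) yb good).
apply: (@right_cvg_eq (cst k) _ y b' _ yb); last exact: cvg_cst.
by move=> z yz _; rewrite /const_right ltNge (le_trans xy (ltW yz)).
Qed.

Lemma ltrace_const_right_gt y : x < y -> y <= b' -> ltrace a b' (const_right x k u) y = k.
Proof.
move=> xy yb; apply: (ltraceE (lt_trans ax xy) yb good).
apply: (@left_cvg_eq (cst k) _ y x _ xy); last exact: cvg_cst.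
by move=> z xz _; rewrite /const_right ltNge (ltW xz).
Qed.

Lemma jump_const_right : jump_restricts a b u a b' (const_right x k u) (~` A).
Proof.
move=> y; rewrite in_itv/= => /andP[ay yb']; have yb := lt_le_trans yb' b'b.
rewrite in_setC mem_cut_set// /jump.
have [xy|yx|<-] := ltgtP x y.
- rewrite rtrace_const_right_ge ?(ltW xy)// ltrace_const_right_gt ?(ltW yb')// subrr.
  by case: B.
- rewrite rtrace_const_right ?(ltW ay)// ltrace_const_right ?(ltW yx)//.
  by case: B.
- rewrite rtrace_const_right_ge// ltrace_const_right// /cut_value.
  by case: B; rewrite ?subrr.
Qed.

Lemma TV_cut phi theta f (Dc Dj : charge_R) : admissible_densities phi theta ->
  leb.-integrable `]a, b[ (EFin \o u) -> bv_decomposition a b u f Dc Dj ->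
  [/\ exists D, weak_derivative a b (const_left x k u) D,
      exists D, weak_derivative a b' (const_right x k u) D &
      (TV phi theta a b (const_left x k u) + TV phi theta a b' (const_right x k u) <=
       TV_energy phi theta a b u f Dc)%E].
Proof.
move=> adm iu decomp; have [[Du wu DuE] intf [_ Dc1] [Dj0 Dj1]] := decomp.
have mA : measurable A by exact: measurable_itv.
have mAc : measurable (~` A) by exact: measurableC.
have mx : measurable ([set x] : set mR) by rewrite -set_itv1; exact: measurable_itv.
have xI : x \in `]a, b[ by rewrite in_itv/= ax.
have xI1 : [set x] `<=` `]a, b[ by move=> _ ->.
(* Neither the absolutely continuous nor the Cantor part has an atom; outside the jump set, the jump
   part has none either. *)
have Dux : Du [set x] = (jump a b u x)%:E.
  rewrite DuE// integral_set1 add0e (Dc1 _ xI) add0e.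
  have [j0|j0] := eqVneq (jump a b u x) 0; last by rewrite Dj1.
  rewrite Dj0 ?j0//; apply/seteqP; split=> // y [-> [_]].
  by rewrite j0 eqxx.
have DuxA : Du ([set x] `&` A)%classic = (rtrace a b u x - k)%:E.
  have xA := mem_cut_set xb; rewrite lexx ltxx in xA.
  rewrite /cut_value; case: B xA => xA.
    rewrite (_ : _ `&` _ = [set x]) ?Dux//.
    by apply/setIidPl => _ ->; exact: set_mem xA.
  rewrite subrr (_ : _ `&` _ = set0) ?charge0//.
  apply/seteqP; split=> // y [-> Ax]; by rewrite (mem_set Ax) in xA.
have ul := rtrace_cvg (ltW ax) xb uoo.
have w1 : weak_derivative a b (const_left x k u) (crestr Du mA).
  exact: (weak_derivative_glue mA ax xb (erefl _) iu wu ul DuxA).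
have w2 : weak_derivative a b' (const_right x k u) (crestr Du mAc).
  apply: (weak_derivative_subitv (lexx a) b'b).
  (* The two pieces add up to u + k, so the derivative of the second is the complementary
     restriction of Du. *)
  have -> : const_right x k u = (fun y => u y + k - const_left x k u y).
    apply/funext => y; rewrite /const_left /const_right.
    by case: ifP => _; rewrite ?addrK// addrAC subrr add0r.
  by apply: weak_derivative_complement w1 => //; exact: integrable_glue.
have d1 := bv_decomposition_restrict (lexx a) (lexx b) DuE decomp w1 jump_const_left.
have d2 := bv_decomposition_restrict (lexx a) b'b DuE decomp w2 jump_const_right.
split; [by exists (crestr Du mA)|by exists (crestr Du mAc)|].
have mf : measurable_fun `]a, b[ (f : mR -> R).
  by apply/measurable_EFinP; exact: (measurable_int leb intf).
apply: le_trans (TV_energy_split Dc mA mAc adm mf (lexx a) (lexx b) (lexx a) b'b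
  jump_const_left jump_const_right).
by apply: leeD; apply: ereal_inf_lbound; do 3 eexists; split; eauto.
Qed.

End cut_at.

End cut.

(** * The competitor and its energy *)

Section running_supremum.
Context {R : realType}.
Implicit Types (a b x y r c l : R) (g : R -> R).

Lemma right_nbhd_le g x l c t : g y @[y --> x^'+] --> l -> l < c -> x < t ->
  exists y, [/\ x < y, y <= t & forall z, x < z -> z < y -> g z <= c].
Proof.
move=> gl lc xt; have [d /= d0 gc] := @cvgr_le _ _ _ _ _ _ gl _ lc.
exists (Num.min t (x + d)); split; first by rewrite lt_min xt ltrDl.
  by rewrite ge_min lexx.
move=> z xz; rewrite lt_min => /andP[zt zd]; apply: gc => //=.
by rewrite /ball/= distrC gtr0_norm ?subr_gt0// ltrBlDl.
Qed.

Lemma left_nbhd_le g x l c t : g y @[y --> x^'-] --> l -> l < c -> t < x ->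
  exists y, [/\ y < x, t <= y & forall z, y < z -> z < x -> g z <= c].
Proof.
move=> gl lc tx; have [d /= d0 gc] := @cvgr_le _ _ _ _ _ _ gl _ lc.
exists (Num.max t (x - d)); split; first by rewrite gt_max tx gtrBl.
  by rewrite le_max lexx.
move=> z + zx; rewrite gt_max => /andP[tz zd]; apply: gc => //=.
by rewrite /ball/= gtr0_norm ?subr_gt0// ltrBlDr addrC -ltrBlDr.
Qed.

(** The last hypothesis puts the supremum strictly above the right limit at a, so it is not merely
    approached at a. The proof is a continuous induction: the set [E] of points up to which g stays
    away from S is shown to have elements beyond its own supremum. At x = r only the left limit is
    consulted. *)
Lemma exists_one_sided_sup a b g r : BVreg a b g -> a < r -> r < b ->
  (exists y, [/\ a < y, y < r & rtrace a b g a < g y]) ->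
  exists x B, [/\ a < x, x <= r & cut_value a b x g B = sup (g @` `]a, r[)].
Proof.
move=> [goo greg] ar rb [y0 [ay0 y0r gy0]]; set S := sup _.
have ab := lt_trans ar rb.
have [P [M dom]] := pointwise_variation_dominated ab goo.
have [K bg] := variation_dominated_bounded ab dom.
have img0 : (g @` `]a, r[) !=set0 by exists (g y0), y0; rewrite //= in_itv/= ay0.
have ubg : has_ubound (g @` `]a, r[).
  exists K => _ [y /= + <-]; rewrite in_itv/= => /andP[ay yr].
  by rewrite (le_trans (ler_norm _))// bg// (lt_trans yr rb).
have gS y : a < y -> y < r -> g y <= S.
  by move=> ay yr; apply: ub_le_sup => //; exists y => //=; rewrite in_itv/= ay.
apply: contrapT => no.
have lS x : a < x -> x <= r -> ltrace a b g x < S.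
  move=> ax xr; rewrite lt_neqAle; apply/andP; split.
    by apply/eqP => E; apply: no; exists x, true.
  apply: cvgr_to_le (ltrace_cvg ax (le_trans xr (ltW rb)) goo) _.
  apply: filterS2 (nbhs_left_gt ax) (nbhs_left_lt x) => z az zx.
  exact: gS az (lt_le_trans zx xr).
have rS x : a < x -> x < r -> rtrace a b g x < S.
  move=> ax xr; rewrite lt_neqAle; apply/andP; split.
    by apply/eqP => E; apply: no; exists x, false; split=> //; exact: ltW.
  apply: cvgr_to_le (rtrace_cvg (ltW ax) (lt_trans xr rb) goo) _.
  apply: filterS2 (nbhs_right_gt x) (nbhs_right_lt xr) => z xz zr.
  exact: gS (lt_trans ax xz) zr.
pose E := [set y | [/\ a < y, y <= r &
  exists2 c, c < S & forall z, a < z -> z < y -> g z <= c]].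
have [aS1 aS2] := midf_lt (lt_le_trans gy0 (gS _ ay0 y0r)).
have E0 : E !=set0.
  have [y [ay yr gy]] := right_nbhd_le (rtrace_cvg (lexx a) ab goo) aS1 ar.
  by exists y; split=> //; exists ((rtrace a b g a + S) / 2).
have ubE : has_ubound E by exists r => y [].
(* If both one-sided limits at [x] and [g x] were below [S], then [g] would stay
   away from [S] up to a point beyond [x], or on all of [(a, r)] when [x = r]. *)
have supE := conj E0 ubE; set x := sup E.
have xr : x <= r by apply: ge_sup => // y [].
have ax : a < x.
  by have [y Ey] := E0; apply: lt_le_trans (ub_le_sup ubE Ey); case: Ey.
have [c cS gc] : exists2 c, c < S & forall z, a < z -> z < x -> g z <= c.
  have lSx := lS x ax xr.
  have [lS2 lS3] := midf_lt lSx.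
  have [t [tx at_ gt_]] := left_nbhd_le (ltrace_cvg ax (le_trans xr (ltW rb)) goo) lS2 ax.
  have xt0 : 0 < x - t by rewrite subr_gt0.
  have [y [ay yr [c2 c2S gc2]]] := sup_adherent xt0 supE.
  rewrite -/x subKr => ty.
  exists (Num.max c2 ((ltrace a b g x + S) / 2)); first by rewrite gt_max c2S.
  move=> z az zx; rewrite le_max; have [zy|yz] := ltP z y; first by rewrite gc2.
  by rewrite gt_ ?orbT// (lt_le_trans ty yz).
move: xr; rewrite le_eqVlt => /predU1P[xE|xr].
  suff : S <= c by rewrite leNgt cS.
  apply: ge_sup => // _ [y /= + <-]; rewrite in_itv/= => /andP[ay yr].
  by apply: gc => //; rewrite xE.
have rSx := rS x ax xr; have lSx := lS x ax (ltW xr).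
have gxS : g x < S.
  have /greg/andP[_] : x \in `]a, b[ by rewrite in_itv/= ax (lt_trans xr rb).
  by rewrite le_max => /orP[] /le_lt_trans; apply.
have [rS2 rS3] := midf_lt rSx.
have [t [xt tr gt_]] := right_nbhd_le (rtrace_cvg (ltW ax) (lt_trans xr rb) goo) rS2 xr.
(* Regularity has bounded g x by the larger one-sided limit, hence below S. The bounds before, at
   and after x now combine into one bound below S. *)
suff : E t by move=> /(ub_le_sup ubE); rewrite leNgt xt.
split=> //; first exact: lt_trans xt.
exists (Num.max c (Num.max (g x) ((rtrace a b g x + S) / 2))).
  by rewrite !gt_max cS gxS.
move=> z az zt; rewrite !le_max; have [xz|zx|<-] := ltgtP x z.
- by rewrite gt_ ?orbT.
- by rewrite gc.
- by rewrite lexx orbT.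
Qed.

End running_supremum.

(** * Norm, essential supremum and zero competitor *)

Section bounds.
Context {R : realType}.
Implicit Types (a b x y k l c : R) (u phi theta w f g : R -> R).
Local Notation mR := (measurableTypeR R).
Local Notation leb := (@lebesgue_measure R).
Local Notation charge_R := (charge (measurableTypeR R) R).

(** 1/p, read as 0 for p = +oo; the width factor (x - a)^(1/p) is then 1, as the supremum norm
    requires. *)
Definition inv_exponent (p : \bar R) : R := if p is r%:E then r^-1 else 0.

Lemma Lp_norm_le a b x (p : \bar R) w (K : R) : (1 <= p)%E ->
  a < x -> x <= b -> 0 <= K -> measurable_fun `]a, b[ (w : mR -> R) ->
  (forall y, a < y -> y < x -> `|w y| <= K) ->
  (forall y, x <= y -> y < b -> w y = 0) ->
  (Lp_norm a b p w <= (K * (x - a) `^ inv_exponent p)%:E)%E.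
Proof.
move=> p1 ax xb K0 mw wK w0.
have mI : measurable (`]a, b[%classic : set mR) by exact: measurable_itv.
have mJ : measurable (`]a, x[%classic : set mR) by exact: measurable_itv.
have wI y : `|(w \_ `]a, b[) y| <= ((cst K) \_ `]a, x[) y.
  rewrite !patchE !mem_setE !in_itv/=.
  have [ay|ya] := ltP a y; rewrite ?normr0//=.
  have [yb|yb] := ltP y b; last first.
    by rewrite ltNge (le_trans xb yb) normr0.
  have [yx|xy] := ltP y x; first exact: wK.
  by rewrite w0// normr0.
rewrite /Lp_norm unlock; case: p p1 => [r| |]//=; last first.
  move=> _; rewrite powRr0 mulr1; case: ifPn => // _.
  apply/ess_supP; apply: aeW => y.
  rewrite -[X in (X <= _)%E]/((`|(w \_ `]a, b[) y|)%:E) lee_fin (le_trans (wI y))//.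
  by rewrite patchE; case: ifP.
rewrite lee_fin => r1; have r0 : 0 < r := lt_le_trans ltr01 r1.
have mwI : measurable_fun setT ((w \_ `]a, b[) : mR -> R).
  by apply/(measurable_restrictT _ mI).
have -> : (K * (x - a) `^ r^-1)%:E = ((K `^ r * (x - a))%:E `^ r^-1)%E.
  rewrite poweR_EFin powRM ?powR_ge0 ?subr_ge0 ?(ltW ax)//.
  by rewrite -powRrM mulfV ?gt_eqF// powRr1.
apply: gt0_ler_poweR; first by rewrite invr_ge0 ltW.
- by rewrite in_itv/= leey andbT integral_ge0// => y _; exact: poweR_ge0.
- rewrite in_itv/= leey andbT lee_fin mulr_ge0 ?powR_ge0// subr_ge0 ltW//.
have -> : ((K `^ r * (x - a))%:E = \int[leb]_(y in `]a, x[) (cst (K `^ r)%:E y))%E.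
  rewrite integral_cst// [X in (_ * X)%E]lebesgue_measure_itv/= lte_fin ax.
  by rewrite -EFinB -EFinM.
rewrite [leRHS]integral_mkcond; apply: ge0_le_integral.
- exact: measurableT.
- by move=> y _; rewrite lee_fin powR_ge0.
- apply/measurable_EFinP; apply: (@measurableT_comp _ _ _ _ _ _ (fun z : R => z `^ r)).
    exact: measurable_powR.
  exact: measurableT_comp.
- by apply/(measurable_restrictT _ mJ); exact: measurable_cst.
move=> y _ /=; rewrite [X in (_ <= X)%E]patchE; have := wI y; rewrite [X in _ <= X]patchE.
case: ifP => _ wyK.
  by rewrite lee_fin ge0_ler_powR// ?nnegrE// ltW.
have /eqP -> : `|(w \_ `]a, b[) y| == 0 by rewrite eq_le wyK normr_ge0.
by rewrite powR0// gt_eqF.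
Qed.

(** The lower bound on E is assumed only for H up to the essential supremum. A one-sided limit above
    it would make g exceed it on an interval of positive length; [x < b'] leaves room for the right
    limit. *)
Lemma ess_sup_on_ge a b b' g x B : a < x -> x < b' -> b' <= b ->
  (pointwise_variation a b g < +oo)%E ->
  ((cut_value a b x g B)%:E <= ess_sup_on a b' g)%E.
Proof.
move=> ax xb' b'b goo; have xb := lt_le_trans xb' b'b.
rewrite leNgt; apply/negP => lt_ess.
have [s [t [as_ st tb' gst]]] : exists s t, [/\ a <= s, s < t, t <= b' &
    forall z, s < z -> z < t -> (ess_sup_on a b' g < (g z)%:E)%E].
  case: B lt_ess => lt_ess.
    have gl := ltrace_cvg ax (ltW xb) goo; rewrite /= in gl.
    have [d /= d0 gd] : \forall z \near x^'-, (ess_sup_on a b' g < (g z)%:E)%E.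
      move: lt_ess; rewrite /cut_value; case: (ess_sup_on a b' g) => [m| |]//.
        by rewrite lte_fin => /(@cvgr_gt _ _ _ _ _ _ gl _); apply: filterS => z; rewrite lte_fin.
      by move=> _; apply: nearW => z; rewrite ltNyr.
    exists (Num.max a (x - d)), x; split=> //; first by rewrite le_max lexx.
    + by rewrite gt_max ax gtrBl.
    + exact: ltW.
    + move=> z; rewrite gt_max => /andP[az zd] zx; apply: gd => //=.
      by rewrite /ball/= gtr0_norm ?subr_gt0// ltrBlDr addrC -ltrBlDr.
  have gl := rtrace_cvg (ltW ax) xb goo; rewrite /= in gl.
  have [d /= d0 gd] : \forall z \near x^'+, (ess_sup_on a b' g < (g z)%:E)%E.
    move: lt_ess; rewrite /cut_value; case: (ess_sup_on a b' g) => [m| |]//.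
      by rewrite lte_fin => /(@cvgr_gt _ _ _ _ _ _ gl _); apply: filterS => z; rewrite lte_fin.
    by move=> _; apply: nearW => z; rewrite ltNyr.
  exists x, (Num.min b' (x + d)); split; first exact: ltW.
  + by rewrite lt_min xb' ltrDl.
  + by rewrite ge_min lexx.
  + move=> z xz; rewrite lt_min => /andP[zb zd]; apply: gd => //=.
    by rewrite /ball/= distrC gtr0_norm ?subr_gt0// ltrBlDl.
have [N [mN N0 subN]] := ess_sup_ge (mrestr leb (@measurable_itv R `]a, b'])) (EFin \o g).
have : (leb `]s, t[%classic <= leb (N `&` `]a, b']))%E.
  apply: le_measure; rewrite ?inE; [exact: measurable_itv| |].
    by apply: measurableI => //; exact: measurable_itv.
  move=> z /=; rewrite in_itv/= => /andP[sz zt]; split.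
    apply: subN => /= gz; have := gst _ sz zt; rewrite ltNge => /negP; apply.
    exact: gz.
  by rewrite in_itv/= (le_lt_trans as_ sz) (le_trans (ltW zt) tb').
rewrite [X in (_ <= X)%E]N0 lebesgue_measure_itv/= lte_fin st -EFinB lee_fin; lra.
Qed.

(** Comparison with the zero function shows that a minimizer g has finite [TV], hence that Dg has a
    decomposition. *)
Lemma TV_zero phi theta a b : admissible_densities phi theta -> a < b ->
  BV a b (cst 0) /\ (TV phi theta a b (cst 0%R) < +oo)%E.
Proof.
move=> adm ab; have [[_ phi0 _ _ _] _] := adm.
have mI : measurable (`]a, b[%classic : set mR) by exact: measurable_itv.
pose D0 : charge_R := czero.
have w0 : weak_derivative a b (cst 0) D0.
  move=> phi' tphi.
  have cphi : continuous phi' by have [dphi1 _ _] := tphi; exact: derivable_continuous.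
  rewrite (charge_integral_eq0 mI)//; last 2 first.
  - exact: continuous_measurable_on.
  - exact: continuous_bounded_on.
  by rewrite oppe0; under eq_integral do rewrite /= mul0r; exact: integral0.
have i0 : leb.-integrable `]a, b[ (EFin \o cst 0) by exact: integrable_cst_itv.
split; first by split=> //; exists D0.
have pv0 : (pointwise_variation a b (cst 0%R : R -> R) < +oo)%E.
  apply: (@variation_dominated_pointwise _ _ _ _ (cst 0) 0).
  by split=> [s _ _|s t _ _ _] /=; rewrite ?normr0// !subrr normr0.
have jump0 y : y \in `]a, b[ -> jump a b (cst 0) y = 0.
  rewrite in_itv/= => /andP[ay yb]; rewrite /jump.
  have good := good_representative_refl pv0.
  rewrite (rtraceE (ltW ay) yb good (cvg_cst (0:R))).
  by rewrite (ltraceE ay (ltW yb) good (cvg_cst (0:R))) subrr.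
have J0 : jump_set a b (cst 0) = set0.
  by apply/seteqP; split=> // y [yI]; rewrite jump0// eqxx.
have decomp : bv_decomposition a b (cst 0) (cst 0) D0 D0.
  split=> //.
  - exists D0 => // A _ _; rewrite /D0 /= /czero !adde0.
    by rewrite integral0.
  - by split=> //; exists set0; split.
  - by split=> // y; rewrite J0.
apply: (@le_lt_trans _ _ 0%E) => //; apply: ereal_inf_lbound.
exists (cst 0), D0, D0; split=> //; rewrite J0 esum_set0 adde0.
rewrite (_ : variation_measure D0 _ = 0%E) ?adde0; last first.
  apply/eqP; rewrite eq_le variation_measure_ge0 andbT.
  by apply: (@variation_measure_le _ _ R D0 mzero) => // E mE _; rewrite /D0 /= /czero /= normr0.
by under eq_integral do rewrite /= normr0 phi0; rewrite integral0.
Qed.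

End bounds.

(** * Adding a constant, to normalize the trace at 0 *)

Section add_constant.
Context {R : realType}.
Implicit Types (a b x y k l c : R) (u phi theta w f g : R -> R).
Local Notation mR := (measurableTypeR R).
Local Notation leb := (@lebesgue_measure R).
Local Notation charge_R := (charge (measurableTypeR R) R).

Lemma pointwise_variation_add_cst a b u k : a < b ->
  (pointwise_variation a b u < +oo)%E ->
  (pointwise_variation a b (fun y => u y + k)%R < +oo)%E.
Proof.
move=> ab uoo; have [P [M [bP dP]]] := pointwise_variation_dominated ab uoo.
apply: (@variation_dominated_pointwise _ _ _ _ P M); split=> // s t as_ st tb.
by rewrite opprD addrACA subrr addr0 dP.
Qed.

Lemma rtrace_add_cst a b u k y : a <= y -> y < b ->
  (pointwise_variation a b u < +oo)%E ->
  rtrace a b (fun y => u y + k) y = rtrace a b u y + k.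
Proof.
move=> ay yb uoo; have ab := le_lt_trans ay yb.
apply: (rtraceE ay yb); first exact/good_representative_refl/pointwise_variation_add_cst.
by apply: cvgD; [exact: rtrace_cvg|exact: cvg_cst].
Qed.

Lemma ltrace_add_cst a b u k y : a < y -> y <= b ->
  (pointwise_variation a b u < +oo)%E ->
  ltrace a b (fun y => u y + k) y = ltrace a b u y + k.
Proof.
move=> ay yb uoo; have ab := lt_le_trans ay yb.
apply: (ltraceE ay yb); first exact/good_representative_refl/pointwise_variation_add_cst.
by apply: cvgD; [exact: ltrace_cvg|exact: cvg_cst].
Qed.

Lemma jump_add_cst a b u k y : (pointwise_variation a b u < +oo)%E ->
  y \in `]a, b[ -> jump a b (fun y => u y + k) y = jump a b u y.
Proof.
move=> uoo; rewrite in_itv/= => /andP[ay yb].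
have rE := rtrace_add_cst k (ltW ay) yb uoo; have lE := ltrace_add_cst k ay (ltW yb) uoo.
by rewrite /jump rE lE opprD addrACA subrr addr0.
Qed.

Lemma jump_set_add_cst a b u k : (pointwise_variation a b u < +oo)%E ->
  jump_set a b (fun y => u y + k) = jump_set a b u.
Proof.
move=> uoo; apply/seteqP; split=> y [yI jy]; split=> //.
  by move: jy; rewrite jump_add_cst.
by rewrite jump_add_cst.
Qed.

Lemma weak_derivative_add_cst a b u (Du : charge_R) k : a < b ->
  leb.-integrable `]a, b[ (EFin \o u) -> weak_derivative a b u Du ->
  weak_derivative a b (fun y => u y + k) Du.
Proof.
move=> ab iu wu phi tphi.
have mI : measurable (`]a, b[%classic : set mR) by exact: measurable_itv.
have total := test_function_derivative_integral tphi ab.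
rewrite (test_function_endpoint tphi) ?lexx ?orbT// in total.
rewrite -(wu _ tphi); move: total.
have [dphi [-> Dphi cdphi]] := test_function_derivative tphi.
move=> total; have iphi := integrable_continuous a b cdphi.
have iuphi := integrable_mul_continuous iu cdphi.
have kphi0 : (k%:E * \int[leb]_(y in `]a, b[) (dphi y)%:E = 0)%E by rewrite total mule0.
rewrite -[RHS]adde0 -kphi0 -integralZl// -integralD//; last first.
  exact: (integrableZl mI k iphi).
by apply: eq_integral => y _ /=; rewrite -EFinM -EFinD mulrDl.
Qed.

Lemma TV_add_cst phi theta a b u k : a < b ->
  (pointwise_variation a b u < +oo)%E -> leb.-integrable `]a, b[ (EFin \o u) ->
  (TV phi theta a b (fun y => u y + k)%R <= TV phi theta a b u)%E.
Proof.
move=> ab uoo iu; apply: le_ereal_inf_tmp => _ [f [Dc [Dj [decomp ->]]]].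
have jE := fun y => jump_add_cst k uoo (y := y); have JE := jump_set_add_cst k uoo.
apply: ereal_inf_lbound; exists f, Dc, Dj; split; last first.
  by rewrite JE; congr (_ + _)%E; apply: eq_esum => y [yI _]; rewrite jE.
have [[Du wu DuE] intf Dc1 [Dj0 Dj1]] := decomp; split=> //.
  by exists Du => //; exact: weak_derivative_add_cst.
by rewrite JE; split=> // y Jy; rewrite Dj1// jE//; case: Jy.
Qed.

End add_constant.

(** * Energy released by the cut and its fidelity cost *)

Section energy_gain.
Context {R : realType}.
Implicit Types (a b x y k l c : R) (u phi theta w f g : R -> R).
Local Notation mR := (measurableTypeR R).
Local Notation leb := (@lebesgue_measure R).

Lemma TV_ge0 phi theta a b u : admissible_densities phi theta ->
  (0 <= TV phi theta a b u)%E.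
Proof.
move=> [[phi_ge0 _ _ _ _] [theta_ge0 _ _ _ _]].
apply: le_ereal_inf_tmp => _ [f [Dc [Dj [_ ->]]]].
apply: adde_ge0; first apply: adde_ge0.
- by apply: integral_ge0 => y _; rewrite lee_fin phi_ge0.
- exact: variation_measure_ge0.
- by apply: esum_ge0 => y _; rewrite lee_fin theta_ge0.
Qed.

Lemma integrable_const_right a b u x k : leb.-integrable `]a, b[ (EFin \o u) ->
  leb.-integrable `]a, b[ (EFin \o const_right x k u).
Proof.
move=> iu; have mI : measurable (`]a, b[%classic : set mR) by exact: measurable_itv.
have := integrableB mI (integrableD mI iu (integrable_cst_itv a b k)) (integrable_glue x k iu).
apply: eq_integrable => // y _ /=; congr _%:E; rewrite /const_right.
by case: ifP => _; ring.
Qed.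

Lemma jump_energy_cut phi theta a b g x delta (B : bool) :
  admissible_densities phi theta -> (pointwise_variation a b g < +oo)%E ->
  leb.-integrable `]a, b[ (EFin \o g) ->
  a < x -> x < a + delta -> a + delta <= b -> (TV phi theta a b g < +oo)%E ->
  let k := cut_value a b x g B in
  BV a b (const_left x k g) /\
  (jump_energy phi theta delta (k - rtrace a b g a)%R +
   TV phi theta a b (const_left x k g) <= TV phi theta a b g)%E.
Proof.
move=> adm goo ig ax xad adb TVoo k.
have xb := lt_le_trans xad adb; have ab := lt_trans ax xb.
have aad := lt_trans ax xad; have delta0 : 0 < delta by move: aad; rewrite ltrDl.
(* A finite infimum is over a nonempty set; any decomposition of Dg yields weak derivatives of both
   pieces. *)
have /ereal_inf_lt[_ [f0 [Dc0 [Dj0 [decomp0 _]]]] _] := TVoo.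
have [w1 [D2 w2] _] := TV_cut B ax xb goo xad adb adm ig decomp0.
split; first by split; [exact: integrable_glue|exact: w1].
pose w := const_right x k g.
have woo : (pointwise_variation a (a + delta)%R w < +oo)%E.
  apply: pointwise_variation_const_right => //.
  exact: (pointwise_variation_subitv aad adb goo).
have iw : leb.-integrable `]a, a + delta[ (EFin \o w).
  apply: integrableS (integrable_const_right x k ig); [exact: measurable_itv..|].
  by move=> y /=; rewrite !in_itv/= => /andP[-> yd]; exact: lt_le_trans adb.
have mw : measurable_fun `]a, a + delta[ (w : mR -> R).
  by apply/measurable_EFinP; exact: (measurable_int leb iw).
pose l := rtrace a b g a.
pose wt := fun t => w (t + a).
have wtoo : (pointwise_variation 0 delta wt < +oo)%E.
  exact: pointwise_variation_translate.
have iwt : leb.-integrable `]0, delta[ (EFin \o wt) by exact: integrable_translate.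
(* Subtracting the trace of g at a makes v admissible for E: its trace at 0 is l - l. Since x < a +
   delta, w is constantly k near a + delta, so the trace of v at delta is k - l. *)
pose v := fun t => wt t + - l.
have gain : (jump_energy phi theta delta (k - l)%R <= TV phi theta a (a + delta)%R w)%E.
  apply: le_trans (TV_translate adm woo mw).
  apply: le_trans (TV_add_cst phi theta (- l) delta0 wtoo iwt).
  apply: ereal_inf_lbound; exists v => //; split.
  - have mI : measurable (`]0, delta[%classic : set mR) by exact: measurable_itv.
    split.
      by have := integrableD mI iwt (integrable_cst_itv 0 delta (- l)); apply: eq_integrable.
    have [D2' D2'E] := charge_pushforward_exists (measurable_translate_by a) D2.
    exists D2'; apply: weak_derivative_add_cst => //.
    exact: weak_derivative_translate w2.
  - have := rtrace_add_cst (- l) (lexx 0) delta0 wtoo; rewrite -/v => ->.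
    have -> := rtrace_translate woo (lexx 0) delta0; rewrite add0r.
    have -> := rtrace_const_right B ax xb goo xad adb (lexx a) ax.
    exact: subrr.
  - have := ltrace_add_cst (- l) delta0 (lexx delta) wtoo; rewrite -/v => ->.
    have -> := ltrace_translate woo delta0 (lexx delta); rewrite (addrC delta).
    by have -> := ltrace_const_right_gt B ax goo xad adb xad (lexx _).
apply: le_ereal_inf_tmp => _ [f [Dc [Dj [decomp ->]]]].
have [_ _ split_le] := TV_cut B ax xb goo xad adb adm ig decomp.
by apply: le_trans split_le; rewrite addeC leeD2l.
Qed.

Lemma fidelity_functional_self phi theta a b g (p : \bar R) lambda gamma :
  (1 <= p)%E -> a < b -> gamma != 0 ->
  fidelity_functional phi theta a b g p lambda gamma g = TV phi theta a b g.
Proof.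
move=> p1 ab gamma0; rewrite /fidelity_functional.
(* A nonzero exponent is essential here: 0 to the power 0 is 1. *)
suff -> : Lp_norm a b p (g \- g) = 0%E by rewrite poweR0r// mule0 adde0.
have -> : g \- g = cst 0 by apply/funext => y /=; rewrite subrr.
have := @Lp_norm_le _ a b b p (cst 0) 0 p1 ab (lexx b) (lexx 0).
rewrite mul0r => L0; apply/eqP; rewrite eq_le Lnorm_ge0 andbT; apply: L0.
- exact: measurable_cst.
- by move=> y _ _ /=; rewrite normr0.
- by [].
Qed.

Lemma fidelity_functional_le phi theta a b g u x (p : \bar R) lambda gamma (K : R) :
  (1 <= p)%E -> a < x -> x <= b -> 0 <= K -> 0 <= lambda -> 0 <= gamma ->
  leb.-integrable `]a, b[ (EFin \o g) -> leb.-integrable `]a, b[ (EFin \o u) ->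
  (forall y, a < y -> y < x -> `|u y - g y| <= K) ->
  (forall y, x <= y -> y < b -> u y = g y) ->
  (fidelity_functional phi theta a b g p lambda gamma u <=
   TV phi theta a b u +
   (lambda * (K * (x - a) `^ inv_exponent p) `^ gamma)%:E)%E.
Proof.
move=> p1 ax xb K0 lambda0 gamma0 ig iu ugK ug.
have mug : measurable_fun `]a, b[ ((u \- g)%R : mR -> R).
  apply: measurable_funB; apply/measurable_EFinP.
    exact: (measurable_int leb iu).
  exact: (measurable_int leb ig).
have ug0 y : x <= y -> y < b -> (u \- g) y = 0 by move=> xy yb; rewrite /= ug// subrr.
have normE := Lp_norm_le p1 ax xb K0 mug ugK ug0.
rewrite /fidelity_functional leeD2l// EFinM -poweR_EFin lee_wpmul2l ?lee_fin//.
apply: gt0_ler_poweR => //; rewrite in_itv/= leey andbT ?Lnorm_ge0//.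
by rewrite lee_fin mulr_ge0// powR_ge0.
Qed.

End energy_gain.

(** * Comparison of exponents *)

Section exponents.
Context {R : realType}.
Implicit Types (alpha eta gamma : R).

(** The power of s in the fidelity term: height s times (s / c)^(1/alpha) to the power 1/p, all
    raised to the power gamma. *)
Definition fidelity_exponent (p : \bar R) alpha gamma : R :=
  gamma * (1 + inv_exponent p / alpha).

Lemma inv_exponent_ge0 (p : \bar R) : (1 <= p)%E -> 0 <= inv_exponent p.
Proof. by case: p => [r| |]//=; rewrite lee_fin invr_ge0; apply: le_trans. Qed.

Lemma threshold_lt_exponent (p : \bar R) alpha eta gamma : (1 <= p)%E -> 0 < alpha ->
  threshold p alpha eta < gamma -> eta < fidelity_exponent p alpha gamma.
Proof.
move=> + alpha0; rewrite /fidelity_exponent; case: p => [r| |]//=; last first.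
  by rewrite mul0r addr0 mulr1.
rewrite lee_fin => r1; have r0 : 0 < r := lt_le_trans ltr01 r1.
have ra0 : 0 < r * alpha by exact: mulr_gt0.
rewrite ltr_pdivrMr ?addr_gt0// => lt.
have -> : gamma * (1 + r^-1 / alpha) = gamma * (r * alpha + 1) / (r * alpha).
  by field; rewrite !gt_eqF.
by rewrite ltr_pdivlMr// mulrC.
Qed.

Lemma fidelity_powRE (p : \bar R) (s c : R) alpha gamma : 0 < s -> 0 < c ->
  (s * ((s / c) `^ alpha^-1) `^ inv_exponent p) `^ gamma =
  s `^ fidelity_exponent p alpha gamma * (c^-1 `^ (inv_exponent p / alpha * gamma)).
Proof.
move=> s0 c0; rewrite powRM ?powR_ge0 ?(ltW s0)// -!powRrM (mulrC alpha^-1).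
rewrite (powRM _ (ltW s0)) ?invr_ge0 ?(ltW c0)// mulrA -powRD ?(gt_eqF s0) ?implybT//.
by congr (_ `^ _ * _ `^ _); rewrite /fidelity_exponent; ring.
Qed.

(** For s <= eps the factor s^(f - e) is at most A / (2 B), so B s^f is at most half of A s^e. The
    factor 2 gives strictness even at s = eps. *)
Lemma powR_gap (A B e f eps s : R) : 0 < A -> 0 < B -> e < f ->
  eps = (A / (2 * B)) `^ (f - e)^-1 -> 0 < s -> s <= eps ->
  B * s `^ f < A * s `^ e.
Proof.
move=> A0 B0; rewrite -subr_gt0 => fe -> s0 seps.
have AB0 : 0 < A / (2 * B) by rewrite divr_gt0// mulr_gt0.
have -> : s `^ f = s `^ (f - e) * s `^ e.
  by rewrite -powRD ?(gt_eqF s0) ?implybT// subrK.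
rewrite mulrA ltr_pM2r ?powR_gt0//.
have : s `^ (f - e) <= A / (2 * B).
  have -> : A / (2 * B) = ((A / (2 * B)) `^ (f - e)^-1) `^ (f - e).
    by rewrite -powRrM mulVf ?gt_eqF// powRr1// ltW.
  by apply: ge0_ler_powR seps; rewrite ?nnegrE ?powR_ge0// ltW.
rewrite -(ler_pM2l B0) => /le_lt_trans; apply.
have -> : B * (A / (2 * B)) = A / 2 by field; rewrite gt_eqF.
by rewrite ltr_pdivrMr// ltr_pMr// ltr1n.
Qed.

End exponents.

(** * Choice of the cut point near the left end *)

Section first_crossing.
Context {R : realType}.
Implicit Types (a b x c alpha delta eps : R) (g : R -> R).

Lemma exists_cut_point a b g alpha c delta eps : a < b -> BVreg a b g ->
  0 < alpha -> 0 < c -> 0 < delta -> delta < b - a -> 0 < eps ->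
  (forall x, a < x -> x <= a + delta ->
     c * (x - a) `^ alpha <= g x - rtrace a b g a) ->
  exists x B, let s := cut_value a b x g B - rtrace a b g a in
    [/\ a < x, x < a + delta, 0 < s, s <= eps & x - a <= (s / c) `^ alpha^-1] /\
    forall y, a < y -> y < x -> rtrace a b g a < g y <= cut_value a b x g B.
Proof.
move=> ab hg alpha0 c0 delta0; rewrite ltrBrDl => adb eps0.
have [goo _] := hg; set l := rtrace a b g a => growth.
have gl : g y @[y --> a^'+] --> l := rtrace_cvg (lexx a) ab goo.
have ad : a < a + delta by rewrite ltrDl.
have leps : l < l + eps by rewrite ltrDl.
have [t [at_ tad gt_]] := right_nbhd_le gl leps ad.
(* g <= l + eps on ]a, t[; taking r strictly below t keeps a cut point x <= r strictly inside ]a, a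
   + delta[. *)
have [ar rt] := midf_lt at_; set r := _ / _ in ar rt.
have rb : r < b := lt_trans (lt_le_trans rt tad) adb.
have [ay0 y0r] := midf_lt ar; set y0 := _ / _ in ay0 y0r.
have gl0 y : a < y -> y < r -> l < g y.
  move=> ay yr; rewrite -subr_gt0; apply: lt_le_trans (growth y ay _).
    by rewrite mulr_gt0// powR_gt0// subr_gt0.
  by rewrite (le_trans _ tad)// ltW// (lt_trans yr).
have [x [B [ax xr kE]]] := exists_one_sided_sup hg ar rb
  (ex_intro _ y0 (And3 ay0 y0r (gl0 _ ay0 y0r))).
exists x, B; set k := cut_value a b x g B in kE *; rewrite /=.
have gimg y : a < y -> y < r -> (g @` `]a, r[) (g y).
  by move=> ay yr; exists y => //=; rewrite in_itv/= ay.
have geps : ubound (g @` `]a, r[) (l + eps).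
  move=> _ [y /= + <-]; rewrite in_itv/= => /andP[ay yr].
  exact: gt_ ay (lt_trans yr rt).
have gk y : a < y -> y < r -> g y <= k.
  move=> ay yr; rewrite kE; apply: ub_le_sup; last exact: gimg.
  by exists (l + eps).
have s0 : 0 < k - l by rewrite subr_gt0; exact: lt_le_trans (gl0 _ ay0 y0r) (gk _ ay0 y0r).
have xad : x < a + delta := lt_le_trans (le_lt_trans xr rt) tad.
split; last first.
  move=> y ay yx; have yr := lt_le_trans yx xr.
  by rewrite gl0//= gk.
split=> //.
  rewrite lerBlDl kE; apply: ge_sup => //.
  by exists (g y0); exact: gimg.
rewrite leNgt; apply/negP => lt.
have p0 : 0 <= ((k - l) / c) `^ alpha^-1 := powR_ge0 _ _.
(* The growth condition is applied at a point y strictly before x, because g <= k is known only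
   before r, and x may equal r. If x were too far, it would give g y > k. *)
rewrite ltrBrDl in lt; have [lt_y yx] := midf_lt lt; set y := (_ + x) / _ in lt_y yx.
have ay : a < y by apply: le_lt_trans lt_y; rewrite lerDl.
rewrite -ltrBrDl in lt_y.
have : (k - l) / c < (y - a) `^ alpha.
  have -> : (k - l) / c = (((k - l) / c) `^ alpha^-1) `^ alpha.
    by rewrite -powRrM mulVf ?gt_eqF// powRr1// divr_ge0// ltW.
  by apply: gt0_ltr_powR; rewrite // nnegrE ?subr_ge0// ltW.
rewrite ltr_pdivrMr// mulrC ltNge => /negP; apply.
apply: le_trans (growth y ay _) _; first exact: ltW (lt_trans yx xad).
by rewrite lerD2r gk// (lt_le_trans yx xr).
Qed.

End first_crossing.

Theorem theorem4p9 (R : realType) (phi theta : R -> R)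
    (hphitheta : admissible_densities phi theta)
    (a b : R) (hab : a < b) (g : R -> R) (hg : BVreg a b g)
    (alpha c delta : R) (halpha : 0 < alpha) (hc : 0 < c)
    (hdelta0 : 0 < delta) (hdelta : delta < b - a)
    (hgrowth : forall x : R, a < x -> x <= a + delta ->
       c * (x - a) `^ alpha <= g x - rtrace a b g a)
    (C eta : R) (hC : 0 < C) (heta : 0 < eta)
    (hE : forall H : R, 0 <= H ->
       (H%:E <= ess_sup_on a (a + delta) g - (rtrace a b g a)%:E)%E ->
       ((C * H `^ eta)%:E <= jump_energy phi theta delta H)%E)
    (p : \bar R) (hp : (1 <= p)%E)
    (lambda gamma : R) (hlambda : 0 < lambda) (hgamma : 0 < gamma)
    (hthreshold : threshold p alpha eta < gamma) :
  ~ is_minimizer (BV a b) (fidelity_functional phi theta a b g p lambda gamma) g.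
Proof.
move=> [[ig _] Fmin].
have [goo _] := hg.
have gamma_neq0 : gamma != 0 by rewrite gt_eqF.
rewrite (fidelity_functional_self _ _ g lambda hp hab gamma_neq0) in Fmin.
have [P [M dom]] := pointwise_variation_dominated hab goo.
have [K bg] := variation_dominated_bounded hab dom.
have TVg : (TV phi theta a b g < +oo)%E.
  (* The functional at 0 is finite because g is bounded; the fidelity estimate is used with x =
     b. *)
  have [BV0 TV0] := TV_zero hphitheta hab; apply: le_lt_trans (Fmin _ BV0) _.
  have [am mb] := midf_lt hab; have K0 := le_trans (normr_ge0 _) (bg _ am mb).
  apply: le_lt_trans (fidelity_functional_le phi theta hp hab (lexx b) K0 (ltW hlambda)
    (ltW hgamma) ig (proj1 BV0) _ _) _.
  - by move=> y ay yb /=; rewrite sub0r normrN; exact: bg.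
  - by move=> y by_ yb; move: (le_lt_trans by_ yb); rewrite ltxx.
  - by rewrite lte_add_pinfty// ltry.
pose kappa := fidelity_exponent p alpha gamma.
have eta_kappa : eta < kappa by exact: threshold_lt_exponent.
pose D := c^-1 `^ (inv_exponent p / alpha * gamma).
have D0 : 0 < lambda * D by rewrite mulr_gt0// powR_gt0// invr_gt0.
(* The threshold of [powR_gap] for A = C and B = lambda D, where D collects the powers of c in the
   fidelity term. *)
have eps0 : 0 < (C / (2 * (lambda * D))) `^ (kappa - eta)^-1.
  by rewrite powR_gt0// divr_gt0// mulr_gt0.
have [x [B]] := exists_cut_point hab hg halpha hc hdelta0 hdelta eps0 hgrowth.
set k := cut_value a b x g B; set s := k - _ => /= -[[ax xad s0 seps x_small] gk].
have adb : a + delta <= b by move: hdelta; rewrite ltrBrDl => /ltW.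
have xb : x < b := lt_le_trans xad adb.
have [BVu gain] := jump_energy_cut B hphitheta goo ig ax xad adb TVg.
rewrite -/k -/s in BVu gain.
have Es : ((C * s `^ eta)%:E <= jump_energy phi theta delta s)%E.
  apply: hE; first exact: ltW.
  by rewrite EFinB leeB//; exact: (ess_sup_on_ge B ax xad adb goo).
have cost : (TV phi theta a b g <= TV phi theta a b (const_left x k g) +
    (lambda * D * s `^ kappa)%:E)%E.
  apply: le_trans (Fmin _ BVu) _.
  apply: le_trans (fidelity_functional_le phi theta hp ax (ltW xb) (ltW s0)
    (ltW hlambda) (ltW hgamma) ig (proj1 BVu) _ _) _.
  - move=> y ay yx; have /andP[ly yk] := gk _ ay yx.
    by rewrite /const_left yx ger0_norm ?subr_ge0// /s lerD2l lerN2 ltW.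
  - by move=> y xy yb; rewrite /const_left ltNge xy.
  rewrite leeD2l// lee_fin -mulrA ler_wpM2l ?(ltW hlambda)//.
  rewrite (mulrC D) -(fidelity_powRE p alpha gamma s0 hc).
  apply: ge0_ler_powR; first exact: ltW.
  - by rewrite nnegrE mulr_ge0 ?powR_ge0// ltW.
  - by rewrite nnegrE mulr_ge0 ?powR_ge0// ltW.
  rewrite ler_wpM2l ?(ltW s0)//; apply: ge0_ler_powR => //.
  - exact: inv_exponent_ge0.
  - by rewrite nnegrE subr_ge0 ltW.
  - by rewrite nnegrE powR_ge0.
(* Needed to cancel this term between [gain] and [cost]. It is bounded by the finite energy of g, as
   E is nonnegative here. *)
have TVufin : TV phi theta a b (const_left x k g) \is a fin_num.
  rewrite ge0_fin_numE ?TV_ge0//; apply: le_lt_trans TVg; apply: le_trans gain.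
  rewrite leeDr//; apply: le_trans Es; rewrite lee_fin mulr_ge0 ?powR_ge0//.
  exact: ltW.
have : ((C * s `^ eta)%:E <= (lambda * D * s `^ kappa)%:E)%E.
  rewrite -(leeD2rE _ _ TVufin) [leRHS]addeC; apply: le_trans cost.
  by apply: le_trans gain; rewrite leeD2r.
by rewrite lee_fin leNgt (powR_gap hC D0 eta_kappa (erefl _)).
Qed.
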